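(* Let $(V,E)$ be a finite graph (with positive edge weights $w_{ij}$) with $\#V=n$, without isolated vertices, let $p\ge1$, let $\alpha$ be the independence number of the graph and let $\lambda_i(\Delta_p)$ be the $i$-th min-max eigenvalue of the normalized graph $p$-Laplacian. Then $$\alpha\le\min\{\#\{i:\lambda_i(\Delta_p)\le1\},\ \#\{i:\lambda_i(\Delta_p)\ge1\}\}.$$ Moreover, for any eigenvector $x$ corresponding to $\lambda_i(\Delta_p)$ whose multiplicity is $r$, the number of connected components of the support of $x$ (in the induced subgraph) is at most $\min\{i+r-1,\ n-i+r\}$.
   Context: The eigenvalue problem of the normalized graph $p$-Laplacian is that of the function pair $(F,G)$ with $F(x)=\sum_{\{i,j\}\in E}w_{ij}|x_i-x_j|^p$ and $G(x)=\sum_{i\in V}\deg_i|x_i|^p$, $\deg_i=\sum_{j:\{i,j\}\in E}w_{ij}$ (with $w_{ij}=1$ in the unweighted case): $(\lambda,x)$ with $x\ne0$ is an eigenpair if $\nabla F(x)\cap\lambda\nabla G(x)\neq\varnothing$, $\nabla$ being the Clarke subdifferential. Min-max eigenvalues: $\lambda_i(\Delta_p)=\inf_{A}\sup_{x\in A}F(x)/G(x)$, infimum over compact symmetric $A\subset\mathbb R^n\setminus\{0\}$ with Krasnoselskii genus $\ge i$, where the genus of a nonempty symmetric set is the least $s\ge1$ such that it admits an odd continuous map to $\mathbb S^{s-1}$. The multiplicity of an eigenvalue is the genus of the set of its eigenvectors. *)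

(* Defs.v *)
From HB Require Import structures.
From mathcomp Require Import all_boot all_order all_algebra.
From mathcomp Require Import all_classical all_reals all_analysis.
Import Order.TTheory GRing.Theory Num.Theory.
Import numFieldNormedType.Exports.

Set Implicit Arguments.
Unset Strict Implicit.
Unset Printing Implicit Defensive.

Local Open Scope classical_set_scope.
Local Open Scope ring_scope.

Definition dotrv (R : realType) (n : nat) (u v : 'rV[R]_n) : R :=
  \sum_(j < n) u 0 j * v 0 j.

(* f°(x; v) = limsup of (f (y + t v) - f y) / t as y --> x and t --> 0+ *)
Definition clarke_dir (R : realType) (n : nat) (f : 'rV[R]_n -> R)
    (x v : 'rV[R]_n) : \bar R :=
  limf_esup
    (fun yt : 'rV[R]_n * R => ((f (yt.1 + yt.2 *: v) - f yt.1) / yt.2)%:E)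
    (filter_prod (nbhs x) (0 : R)^'+).

Definition clarke_subdiff (R : realType) (n : nat) (f : 'rV[R]_n -> R)
    (x : 'rV[R]_n) : set 'rV[R]_n :=
  [set xi | forall v : 'rV[R]_n, ((dotrv xi v)%:E <= clarke_dir f x v)%E].

Definition eigenpair (R : realType) (n : nat) (F G : 'rV[R]_n -> R)
    (lam : R) (x : 'rV[R]_n) : Prop :=
  x != 0 /\
  clarke_subdiff F x `&` [set lam *: eta | eta in clarke_subdiff G x] !=set0.

Definition symmetric_set (R : realType) (n : nat) (A : set 'rV[R]_n) : Prop :=
  forall x, A x -> A (- x).

(* The Euclidean unit sphere S^(s-1) of R^s, which is empty for s = 0; the
   library norm on 'rV[R]_s is the sup norm, hence the explicit sum. *)
Definition unit_sphere (R : realType) (s : nat) : set 'rV[R]_s :=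
  [set y | \sum_(j < s) (y 0 j) ^+ 2 = 1].

Definition odd_sphere_map (R : realType) (n : nat) (A : set 'rV[R]_n)
    (s : nat) : Prop :=
  exists f : 'rV[R]_n -> 'rV[R]_s,
    [/\ {within A, continuous f},
        (forall x, A x -> f (- x) = - f x)
      & (forall x, A x -> unit_sphere (f x))].

(* Krasnoselskii genus of a symmetric set: +oo if there is no odd map to any
   sphere. As the sphere is empty for s = 0, the value 0 is taken only by the
   empty set, and for nonempty A the infimum ranges over s >= 1. *)
Definition genus (R : realType) (n : nat) (A : set 'rV[R]_n) : \bar R :=
  ereal_inf [set (s%:R : R)%:E | s in [set s : nat | odd_sphere_map A s]].

Definition minmax (R : realType) (n : nat) (F G : 'rV[R]_n -> R)
    (i : nat) : \bar R :=
  ereal_inf [set ereal_sup [set (F x / G x)%:E | x in A] |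
             A in [set A : set 'rV[R]_n |
                   [/\ compact A, symmetric_set A, A `<=` [set~ 0]
                     & ((i%:R : R)%:E <= genus A)%E]]].

(* Each unordered edge {i, j} is counted once, as the pair with i < j. *)
Definition plap_num (R : realType) (n : nat) (e : rel 'I_n)
    (w : 'I_n -> 'I_n -> R) (p : R) (x : 'rV[R]_n) : R :=
  \sum_(i < n) \sum_(j < n | (i < j)%N && e i j)
    w i j * `|x 0 i - x 0 j| `^ p.

Definition wdeg (R : realType) (n : nat) (e : rel 'I_n)
    (w : 'I_n -> 'I_n -> R) (i : 'I_n) : R :=
  \sum_(j < n | e i j) w i j.

Definition plap_den (R : realType) (n : nat) (e : rel 'I_n)
    (w : 'I_n -> 'I_n -> R) (p : R) (x : 'rV[R]_n) : R :=
  \sum_(i < n) wdeg e w i * `|x 0 i| `^ p.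

Definition plap_eigenpair (R : realType) (n : nat) (e : rel 'I_n)
    (w : 'I_n -> 'I_n -> R) (p : R) (lam : R) (x : 'rV[R]_n) : Prop :=
  eigenpair (plap_num e w p) (plap_den e w p) lam x.

Definition plap_minmax (R : realType) (n : nat) (e : rel 'I_n)
    (w : 'I_n -> 'I_n -> R) (p : R) (i : nat) : \bar R :=
  minmax (plap_num e w p) (plap_den e w p) i.

Definition plap_multiplicity (R : realType) (n : nat) (e : rel 'I_n)
    (w : 'I_n -> 'I_n -> R) (p : R) (lam : R) : \bar R :=
  genus [set x | plap_eigenpair e w p lam x].

Definition independent (n : nat) (e : rel 'I_n) (S : {set 'I_n}) : bool :=
  [forall u in S, forall v in S, ~~ e u v].

Definition independence_number (n : nat) (e : rel 'I_n) : nat :=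
  \max_(S : {set 'I_n} | independent e S) #|S|.

Definition supp (R : realType) (n : nat) (x : 'rV[R]_n) : {set 'I_n} :=
  [set i : 'I_n | x 0 i != 0]%SET.

Definition induced_rel (n : nat) (e : rel 'I_n) (S : {set 'I_n}) : rel 'I_n :=
  [rel u v | [&& u \in S, v \in S & e u v]].

(* n_comp counts the components lying inside the set given as its second
   argument, so the isolated vertices outside S are not counted. *)
Definition num_components (n : nat) (e : rel 'I_n) (S : {set 'I_n}) : nat :=
  n_comp (induced_rel e S) S.

(* Main.v *)
Require Import Defs.
From HB Require Import structures.
From mathcomp Require Import all_boot all_order all_algebra.
From mathcomp Require Import all_classical all_reals all_analysis.
From mathcomp Require Import zify ring lra.
Import Order.TTheory GRing.Theory Num.Theory.
Import numFieldNormedType.Exports.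
Set Implicit Arguments.
Unset Strict Implicit.
Unset Printing Implicit Defensive.

(** Write [F] and [G] for the numerator and the denominator of the Rayleigh
    quotient.

    Both assertions come from one observation. Cut a vector [x] into [k] blocks
    of its support which no edge joins. Rescaling the blocks independently
    multiplies the contribution of each block to [F] and to [G] by the same
    power, so if every block has Rayleigh quotient [c], then [F = c G] on the
    whole [k]-dimensional span of the blocks. The unit sphere of that span has
    genus at least [k] by the Borsuk-Ulam theorem ([borsuk_ulam]), whence
    [lambda_i <= c] for [i <= k]. A symmetric set which avoids the span is
    mapped oddly to nonzero vectors of [R^(n-k)] by a linear map whose kernel
    is the span, so a set of genus larger than [n - k] meets the span, whence
    [lambda_i >= c] for [i > n - k]. The vertices of an independent set form
    such a family with [c = 1]: this is the first assertion. For an eigenvector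
    of [lambda], the restrictions to the components of the support form such a
    family with [c = lambda], as one sees by testing the eigenvalue equation
    against each of them ([eigen_blocks]).

    For the second assertion these inequalities only say that several
    consecutive min-max eigenvalues coincide with [lambda]; that the
    multiplicity then has to be large is the Lusternik-Schnirelmann theorem
    ([sublevel_odd_map]): if the symmetric sets below level [c] have genus less
    than [j] and the critical directions of level [c] have genus at most [s],
    then the symmetric sets slightly above level [c] have genus less than
    [j + s]. Its usual proof deforms sublevel sets along a pseudo-gradient. As
    [F] and [G] may fail to be differentiable when [p = 1], convexity is used
    instead. For a nonnegative level, a separation argument shows that [x] is
    an eigenvector as soon as no [v] satisfies
    [F (x + v) - F x + c (G (x - v) - G x) < 0]; such a [v], when it exists, is
    a direction in which [F - c G] decreases uniformly near [x]. Finitely many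
    small moves along such directions compose to an odd deformation which
    strictly lowers [F - c G] on any compact set free of critical points.

    The Borsuk-Ulam theorem is proved by Ky Fan's parity argument: in an
    antipodally labelled fine subdivision of the octahedron without
    complementary edges, the number of simplices with alternating labels is odd
    in each dimension, and such a simplex of the top dimension uses more labels
    than the target has coordinates. *)

(** * Chains modulo 2 and Ky Fan's parity count *)

Section Chains.
Variable P : eqType.
Implicit Types (s t : seq P) (c : seq (seq P)) (f : seq P -> bool).

(** A chain modulo 2 is a list of simplices, a simplex is the list of its
    vertices, and [f] is a cochain. Chains are only compared through their
    pairings with all cochains, which spares a quotient. *)
Definition chain_sum f c : bool := \big[addb/false]_(s <- c) f s.

Fixpoint faces s : seq (seq P) :=
  if s is x :: s' then s' :: map (cons x) (faces s') else [::].

Definition cobd f s : bool := chain_sum f (faces s).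

Lemma chain_sum_seq1 f s : chain_sum f [:: s] = f s.
Proof. by rewrite /chain_sum big_seq1. Qed.

Lemma chain_sum_cat f c1 c2 :
  chain_sum f (c1 ++ c2) = chain_sum f c1 (+) chain_sum f c2.
Proof. by rewrite /chain_sum big_cat. Qed.

Lemma chain_sum_addb f g c :
  chain_sum (fun s => f s (+) g s) c = chain_sum f c (+) chain_sum g c.
Proof. by rewrite /chain_sum big_split. Qed.

Lemma chain_sum_flatten f (h : seq P -> seq (seq P)) c :
  chain_sum f (flatten (map h c)) = chain_sum (fun s => chain_sum f (h s)) c.
Proof. by rewrite /chain_sum big_flatten big_map. Qed.

Lemma eq_chain_sum f g c : f =1 g -> chain_sum f c = chain_sum g c.
Proof. by move=> fg; apply: eq_bigr. Qed.

Lemma cobd_cons f x s : cobd f (x :: s) = f s (+) cobd (f \o cons x) s.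
Proof. by rewrite /cobd /chain_sum /= big_cons big_map. Qed.

(** The cone identity [cobd_cons] produces every face of codimension two
    twice. *)
Lemma cobd_cobd f s : cobd (cobd f) s = false.
Proof.
elim: s f => [|x s IHs] f; first by rewrite /cobd /chain_sum big_nil.
rewrite cobd_cons.
under [X in _ (+) X]eq_chain_sum do rewrite /= cobd_cons.
by rewrite chain_sum_addb [X in _ (+) (_ (+) X)]IHs addbF addbb.
Qed.

Lemma eq_in_chain_sum f g c : {in c, f =1 g} -> chain_sum f c = chain_sum g c.
Proof. by move=> fg; apply: eq_big_seq. Qed.

Lemma size_faces s t : t \in faces s -> size s = (size t).+1.
Proof.
elim: s t => //= x s IHs t; rewrite inE => /predU1P[->//|].
by case/mapP => u /IHs -> ->.
Qed.

Lemma faces_subseq s t : t \in faces s -> subseq t s.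
Proof.
elim: s t => //= x s IHs t; rewrite inE => /predU1P[->|].
  exact: subseq_cons.
by case/mapP => u /IHs us ->; rewrite /= eqxx.
Qed.

End Chains.

Section MapChains.
Variables P Q : eqType.

Lemma chain_sum_map f (h : seq P -> seq Q) c :
  chain_sum f (map h c) = chain_sum (f \o h) c.
Proof. by rewrite /chain_sum big_map. Qed.

Lemma faces_map (h : P -> Q) s : faces (map h s) = map (map h) (faces s).
Proof.
elim: s => //= x s ->; congr cons; rewrite -!map_comp.
exact: eq_map.
Qed.

End MapChains.

Section Subdivision.
Variable P : eqType.
Implicit Types (s t : seq P) (f : seq P -> bool).
Variable centre : seq P -> P.

(** Coning from [centre s] over the subdivided boundary; the fuel [d] is the
    number of vertices of [s]. *)
Fixpoint subdivide d s : seq (seq P) :=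
  if d is d'.+1 then map (cons (centre s)) (flatten (map (subdivide d') (faces s)))
  else [:: s].

(** Subdivision is a chain map. The boundary of a cone is its base plus the
    cone over the boundary of the base, and that last term vanishes because
    the base is itself, by induction, a subdivided boundary. *)
Lemma chain_sum_cobd_subdivide d f s : size s = d.+1 ->
  chain_sum (cobd f) (subdivide d.+1 s) = cobd (fun t => chain_sum f (subdivide d t)) s.
Proof.
elim: d f s => [|d IHd] f s ss.
  by case: s ss => [|x []] //= _; rewrite /cobd /chain_sum /= !(big_cons, big_nil).
rewrite [subdivide _ _]/= chain_sum_map chain_sum_flatten.
under eq_chain_sum => t do under eq_chain_sum => u do rewrite /= cobd_cons.
under eq_chain_sum => t do rewrite chain_sum_addb.
rewrite chain_sum_addb -[X in X (+) _ = _]/(cobd _ _).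
set g := f \o _.
suff -> : chain_sum (fun t => chain_sum (cobd g) (subdivide d.+1 t)) (faces s) = false
  by rewrite addbF.
rewrite -(cobd_cobd (fun t => chain_sum g (subdivide d t)) s) {2}/cobd.
by apply: eq_in_chain_sum => t /size_faces; rewrite ss => -[/esym /IHd].
Qed.

End Subdivision.

Section HemisphereChains.
Variables (P : eqType) (neg : P -> P) (negK : involutive neg).

(** [c d] consists of simplices with [d] vertices; it plays the role of a
    hemisphere of dimension [d - 1], whose boundary is the union of the two
    antipodal hemispheres one dimension lower. *)
Definition hemispheres (c : nat -> seq (seq P)) : Prop :=
  (forall f, chain_sum (cobd f) (c 1) = f [::]) /\
  (forall d f, chain_sum (cobd f) (c d.+2) =
               chain_sum f (c d.+1) (+) chain_sum (f \o map neg) (c d.+1)).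

Lemma chain_sum_cobd_map f c :
  chain_sum (cobd f \o map neg) c = chain_sum (cobd (f \o map neg)) c.
Proof. by apply: eq_chain_sum => s; rewrite /= /cobd faces_map chain_sum_map. Qed.

Variable e : nat -> P.

(** Hemispheres of the boundary of the cross-polytope with vertices [e i] and
    [neg (e i)]. *)
Fixpoint octahedron d : seq (seq P) :=
  if d is d'.+1 then
    map (cons (e d')) (if d' is 0 then [:: [::]]
                       else octahedron d' ++ map (map neg) (octahedron d'))
  else [::].

Lemma octahedronSS d : octahedron d.+2 =
  map (cons (e d.+1)) (octahedron d.+1 ++ map (map neg) (octahedron d.+1)).
Proof. by []. Qed.

(** The two lower hemispheres form a cycle, so the boundary of the cone over
    them is their union. *)
Lemma hemispheres_octahedron : hemispheres octahedron.
Proof.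
have mapK : involutive (map neg) := mapK negK.
pose sphere_cycle d := forall g, chain_sum (cobd g) (octahedron d.+1) (+)
  chain_sum (cobd (g \o map neg)) (octahedron d.+1) = false.
have cone d : sphere_cycle d -> forall f, chain_sum (cobd f) (octahedron d.+2) =
    chain_sum f (octahedron d.+1) (+) chain_sum (f \o map neg) (octahedron d.+1).
  move=> cyc f; rewrite octahedronSS chain_sum_map.
  under eq_chain_sum => u do rewrite /= cobd_cons.
  rewrite chain_sum_addb !chain_sum_cat !(chain_sum_map _ (map neg)).
  by rewrite chain_sum_cobd_map cyc addbF.
suff cyc d : sphere_cycle d.
  split=> [f|d f]; last exact: cone.
  by rewrite chain_sum_seq1 cobd_cons /cobd /chain_sum big_nil addbF.
elim: d => [|d IHd] g.
  by rewrite !chain_sum_seq1 !cobd_cons /= /cobd /chain_sum !big_nil !addbF addbb.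
rewrite !cone// [X in _ (+) (_ (+) X)](eq_chain_sum (g := g)).
  by rewrite [X in _ (+) X]addbC addbb.
by move=> u; rewrite /= mapK.
Qed.

Variable centre : seq P -> P.

Definition subdivide_chains (c : nat -> seq (seq P)) d : seq (seq P) :=
  flatten (map (subdivide centre d) (c d)).

Lemma subdivide_map d s : (forall t, centre (map neg t) = neg (centre t)) ->
  subdivide centre d (map neg s) = map (map neg) (subdivide centre d s).
Proof.
move=> centreN; elim: d s => //= d IHd s.
rewrite faces_map centreN -!map_comp (eq_map (g := map (map neg) \o subdivide centre d) IHd).
by rewrite map_comp -map_flatten -!map_comp.
Qed.

Lemma hemispheres_subdivide (c : nat -> seq (seq P)) :
  (forall t, centre (map neg t) = neg (centre t)) ->
  (forall d s, s \in c d -> size s = d) ->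
  hemispheres c -> hemispheres (subdivide_chains c).
Proof.
move=> centreN sz [c1 cS].
have sdE d f : chain_sum (cobd f) (subdivide_chains c d.+1) =
    chain_sum (cobd (fun t => chain_sum f (subdivide centre d t))) (c d.+1).
  rewrite chain_sum_flatten; apply: eq_in_chain_sum => s /sz.
  exact: chain_sum_cobd_subdivide.
split=> [f|d f]; first by rewrite sdE c1 /= chain_sum_seq1.
rewrite sdE cS !chain_sum_flatten; congr (_ (+) _).
by apply: eq_chain_sum => s; rewrite -chain_sum_map -subdivide_map.
Qed.

Lemma subdivide_size d s t : size s = d -> t \in subdivide centre d s -> size t = d.
Proof.
elim: d s t => [|d IHd] s t ss /=; first by rewrite inE => /eqP ->.
case/mapP => u /flatten_mapP[v vs uv] -> /=; congr S; apply: IHd uv.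
by have := size_faces vs; rewrite ss => -[].
Qed.

End HemisphereChains.

Section FanCounting.

Fixpoint alternating (b : bool) (l : seq bool) : bool :=
  if l is a :: l' then (a == b) && alternating (~~ b) l' else true.

(** A nonempty alternating list loses this property unless one of its ends is
    deleted, and just one of these deletions leaves the first sign equal to
    [b]. In a list which is not alternating, the entries whose deletion makes
    it alternate from [b] come in pairs. *)
Lemma cobd_alternating b l :
  cobd (alternating b) l = alternating b l (+) alternating (~~ b) l.
Proof.
elim: l b => [|a l IHl] b /=; first by rewrite /cobd /chain_sum big_nil.
rewrite cobd_cons negbK.
have [->|/negPf ab] := eqVneq a b.
  rewrite (_ : (b == ~~ b) = false) ?addbF /=; last by case: b.
  under [X in _ (+) X]eq_chain_sum => t do rewrite /= eqxx /=.
  by rewrite -[X in _ (+) X]/(cobd (alternating (~~ b)) l) IHl negbK addbCA addbb addbF.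
rewrite (_ : a == ~~ b) /=; last by case: a b ab => -[].
under [X in _ (+) X]eq_chain_sum => t do rewrite /= ab /=.
by rewrite /chain_sum big1// addbF.
Qed.

Lemma alternating_negb b l : alternating b (map negb l) = alternating (~~ b) l.
Proof. by elim: l b => //= a l IHl b; rewrite IHl; case: a b => -[]. Qed.

(** Up to a permutation, the faces of [s] are the lists [rem x s] for [x] in
    [s]. *)
Lemma cobd_perm (P : eqType) (f : seq P -> bool) :
  (forall s t, perm_eq s t -> f s = f t) ->
  forall s t, perm_eq s t -> cobd f s = cobd f t.
Proof.
move=> fP.
have remE s : cobd f s = \big[addb/false]_(x <- s) f (rem x s).
  elim: s f fP => [|x s IHs] f fP; first by rewrite /cobd /chain_sum !big_nil.
  rewrite cobd_cons big_cons /= eqxx IHs => [|u v uv]; last first.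
    by apply: fP; rewrite perm_cons.
  congr (_ (+) _); apply: eq_big_seq => y ys; apply: fP.
  have [->|_//] := eqVneq x y.
  by rewrite perm_sym; exact: perm_to_rem.
move=> s t st; rewrite !remE (perm_big _ st); apply: eq_bigr => x _.
apply: fP; have [xs|xs] := boolP (x \in s); last first.
  by rewrite !rem_id// -(perm_mem st).
rewrite -(perm_cons x) (perm_trans _ (perm_to_rem _)) -?(perm_mem st)//.
by rewrite (perm_trans _ st)// perm_sym perm_to_rem.
Qed.

(** A code [c] stands for the label [c./2] with the sign [odd c]; [flip]
    changes the sign and keeps the label. *)
Definition flip c := if odd c then c.-1 else c.+1.

Lemma odd_flip c : odd (flip c) = ~~ odd c.
Proof. by rewrite /flip; case: c => //= c; case E: (odd c); rewrite /= E. Qed.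

Lemma half_flip c : (flip c)./2 = c./2.
Proof. by rewrite /flip; case: ifP; lia. Qed.

Definition non_complementary (l : seq nat) : Prop :=
  {in l &, forall a b, a./2 = b./2 -> a = b}.

(** The signs alternate when the vertices are listed by increasing label. As
    sorting the codes makes this independent of the order of the vertices,
    degenerate simplices and equal labels need no special treatment. *)
Definition fan b (l : seq nat) : bool :=
  alternating b (map odd (sort leq l)).

Lemma fan_perm b l l' : perm_eq l l' -> fan b l = fan b l'.
Proof.
by move=> /(perm_sortP leq_total leq_trans anti_leq); rewrite /fan => ->.
Qed.

Lemma cobd_fan b l : cobd (fan b) l = fan b l (+) fan (~~ b) l.
Proof.
rewrite (@cobd_perm _ (fan b) _ _ (sort leq l)); last by rewrite perm_sym perm_sort.
  rewrite -[RHS]cobd_alternating /cobd faces_map chain_sum_map.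
  apply: eq_in_chain_sum => t tl; rewrite /fan sorted_sort//.
    exact: leq_trans.
  apply: (subseq_sorted leq_trans (faces_subseq tl)).
  exact: (sort_sorted leq_total).
by move=> s t; apply: fan_perm.
Qed.

(** Without complementary pairs, flipping all the signs does not disturb the
    order of the codes. *)
Lemma fan_flip b l : non_complementary l -> fan b (map flip l) = fan (~~ b) l.
Proof.
move=> nc; rewrite /fan -alternating_negb.
suff -> : sort leq (map flip l) = map flip (sort leq l).
  rewrite -!map_comp; congr alternating; apply: eq_map => c /=.
  exact: odd_flip.
apply: (sorted_eq leq_trans anti_leq); first exact: (sort_sorted leq_total).
  rewrite sorted_map; apply: (sub_in_sorted (P := mem l) (e := leq)).
  - move=> x y xl yl; rewrite /= leq_eqVlt => /predU1P[->//|xy].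
    have [/(nc x y xl yl)|xy2] := eqVneq x./2 y./2; first by lia.
    by have := half_flip x; have := half_flip y; lia.
  - by apply/allP => x; rewrite mem_sort.
  - exact: (sort_sorted leq_total).
rewrite perm_sort perm_sym; apply: perm_map; exact: permEl (perm_sort _ _).
Qed.

(** Consecutive codes with opposite signs have different labels, so an
    alternating simplex has pairwise distinct labels. *)
Lemma fan_size m b l : non_complementary l -> (forall c, c \in l -> c./2 < m) ->
  fan b l -> size l <= m.
Proof.
move=> nc lm.
have : sorted leq (sort leq l) by exact: (sort_sorted leq_total).
have {}nc : non_complementary (sort leq l).
  by move=> x y; rewrite !mem_sort; exact: nc.
have {}lm c : c \in sort leq l -> c./2 < m by rewrite mem_sort; exact: lm.
rewrite /fan -(size_sort leq l); move: (sort leq l) nc lm => {}l nc lm srt alt.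
have lt : sorted ltn (map half l).
  elim: l b nc srt alt {lm} => //= x [|y l] //= IHl b nc /andP[xy srt].
  move=> /and3P[/eqP xb /eqP yb alt].
  apply/andP; split.
    have := nc x y; rewrite !inE !eqxx orbT => /(_ isT isT) //.
    have : x != y by apply: contraTneq (isT) => xy'; move: yb; rewrite -xb xy'; case: odd.
    by move=> xy' nxy; have [/nxy|] := eqVneq x./2 y./2; lia.
  apply: (IHl (~~ b)) => //=; last by rewrite yb eqxx.
  by move=> u v ul vl; apply: nc; rewrite inE ?ul ?vl orbT.
rewrite -(size_map half) -(size_iota 0 m); apply: uniq_leq_size.
  exact: sorted_uniq ltn_trans ltnn _ lt.
by move=> _ /mapP[c /lm cm ->]; rewrite mem_iota.
Qed.

(** Ky Fan's argument. Let [A d] be the parity of the number of alternating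
    simplices, of either first sign, in the hemisphere [c d]. By [cobd_fan] it
    is the number of positive alternating faces in the boundary of [c d],
    hence the number of positive ones in [c (d - 1)] plus the number of
    positive ones in its antipode. The latter are the negative ones of
    [c (d - 1)], so [A d = A (d - 1)]; and [A 1] is odd because the boundary
    of [c 1] is the empty simplex. *)
Lemma exists_alternating_simplex (P : eqType) (neg : P -> P) (code : P -> nat)
    (c : nat -> seq (seq P)) d :
  hemispheres neg c ->
  (forall k s, k <= d -> s \in c k ->
    {in s, forall x, code (neg x) = flip (code x)} /\
    non_complementary (map code s)) ->
  exists2 s, s \in c d.+1 & exists b, fan b (map code s).
Proof.
move=> [c1 cS] codeP; pose f b s := fan b (map code s).
have cobd_f s : cobd (f true) s = f true s (+) f false s.
  by rewrite -[RHS]cobd_fan /cobd faces_map chain_sum_map.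
have fN k : k <= d ->
    chain_sum (f true \o map neg) (c k) = chain_sum (f false) (c k).
  move=> kd; apply: eq_in_chain_sum => s /(codeP k s kd)[codeN nc].
  rewrite /f /= -map_comp (_ : map _ s = map (flip \o code) s).
    by rewrite (map_comp flip) fan_flip.
  exact/eq_in_map.
have total k : k <= d ->
    chain_sum (fun s => f true s (+) f false s) (c k.+1) = true.
  elim: k => [|k IHk] kd.
    by under eq_chain_sum do rewrite -cobd_f; rewrite c1.
  under eq_chain_sum do rewrite -cobd_f.
  by rewrite cS fN// -chain_sum_addb IHk// ltnW.
have [/hasP[s sd fs]|nohas] := boolP (has (fun s => f true s || f false s) (c d.+1)).
  by exists s => //; case/orP: fs; [exists true|exists false].
have := total d (leqnn d); rewrite /chain_sum big_seq big1// => s sd.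
by have := hasPn nohas s sd; rewrite negb_or => /andP[/negPf -> /negPf ->].
Qed.

End FanCounting.

Local Open Scope classical_set_scope.
Local Open Scope ring_scope.

(** * Barycentric subdivision of the octahedron *)

Section RowNorm.
Variables (R : realType) (n : nat).
Implicit Types x y : 'rV[R]_n.

Lemma coord_le_norm x j : `|x 0 j| <= `|x|.
Proof.
by rewrite [leRHS]/Num.norm /= mx_normrE; apply/bigmax_geP; right; exists (0, j).
Qed.

Lemma norm_le_coord x r : 0 <= r -> (forall j, `|x 0 j| <= r) -> `|x| <= r.
Proof.
move=> r0 xr; rewrite [leLHS]/Num.norm /= mx_normrE; apply/bigmax_leP; split=> //.
by case=> i j _ /=; rewrite (ord1 i).
Qed.

End RowNorm.

Section Barycentric.
Variables (R : realType) (k : nat).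
Implicit Types (x y z : 'rV[R]_k) (s t : seq 'rV[R]_k).

Definition barycentre s : 'rV[R]_k := (size s)%:R^-1 *: \sum_(x <- s) x.

Lemma barycentreN s : barycentre (map -%R s) = - barycentre s.
Proof. by rewrite /barycentre size_map big_map sumrN scalerN. Qed.

Lemma barycentre_sub z s : s != [::] ->
  z - barycentre s = (size s)%:R^-1 *: \sum_(x <- s) (z - x).
Proof.
move=> s0; rewrite /barycentre sumrB scalerBr; congr (_ - _).
have -> : \sum_(x <- s) z = (size s)%:R *: z.
  by rewrite big_const_seq count_predT iter_addr_0 scaler_nat.
by rewrite scalerA mulVf ?scale1r// pnatr_eq0 size_eq0.
Qed.

Lemma barycentre_ball z s r : s != [::] ->
  {in s, forall x, `|z - x| <= r} -> `|z - barycentre s| <= r.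
Proof.
move=> s0 sr; rewrite barycentre_sub// normrZ ger0_norm ?invr_ge0//.
rewrite mulrC ler_pdivrMr ?ltr0n ?lt0n ?size_eq0//.
apply: le_trans (ler_norm_sum _ _ _) _; rewrite big_seq.
apply: le_trans (ler_sum _ _) _; first by move=> x; exact: sr.
by rewrite -big_seq big_const_seq count_predT iter_addr_0 mulr_natr.
Qed.

(** Closure under barycentres of lists replaces convexity: it is all that
    subdivision can see. *)
Definition barycentric_closed (Q : 'rV[R]_k -> Prop) :=
  forall s, s != [::] -> {in s, forall x, Q x} -> Q (barycentre s).

Lemma subdivide_closed Q d s t : barycentric_closed Q -> size s = d ->
  {in s, forall x, Q x} -> t \in subdivide barycentre d s -> {in t, forall x, Q x}.
Proof.
move=> Qc; elim: d s t => [|d IHd] s t ss sQ /=; first by rewrite inE => /eqP ->.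
case/mapP => u /flatten_mapP[v vs uv] -> x; rewrite inE => /predU1P[->|].
  by apply: Qc => //; rewrite -size_eq0 ss.
apply: (IHd v) => // [|y yv]; first by have := size_faces vs; rewrite ss => -[].
by apply: sQ; exact: (mem_subseq (faces_subseq vs)).
Qed.

Definition mesh_le r s : Prop := {in s &, forall x y, `|x - y| <= r}.

(** The classical estimate: a barycentre of at most [D] points lies within
    [1 - 1/D] times the diameter of each of these points. A single factor is
    used in all dimensions so that iteration is immediate. *)
Lemma subdivide_mesh D d s t r : (0 < D)%N -> 0 <= r -> (d <= D)%N -> size s = d ->
  mesh_le r s -> t \in subdivide barycentre d s ->
  mesh_le ((1 - D%:R^-1) * r) t.
Proof.
move=> D0 r0; set rho := 1 - _.
elim: d s t => [|d IHd] s t dD ss sr /=.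
  by rewrite inE => /eqP ->; case: s ss {sr}.
case/mapP => u /flatten_mapP[v vs uv] ->.
have sv : size v = d by have := size_faces vs; rewrite ss => -[].
have sub_v : {subset v <= s} := mem_subseq (faces_subseq vs).
have s0 : s != [::] by rewrite -size_eq0 ss.
have rho0 : 0 <= rho by rewrite subr_ge0 invf_le1 ?ler1n ?ltr0n.
have sb x : x \in s -> `|barycentre s - x| <= rho * r.
  move=> xs; rewrite distrC barycentre_sub// normrZ ger0_norm ?invr_ge0//.
  rewrite (perm_big _ (perm_to_rem xs)) big_cons /= subrr add0r ss.
  have : `|\sum_(y <- rem x s) (x - y)| <= d%:R * r.
    apply: le_trans (ler_norm_sum _ _ _) _; rewrite big_seq.
    apply: le_trans (ler_sum _ _) _; first by move=> y /mem_rem ys; exact: sr.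
    rewrite -big_seq big_const_seq count_predT iter_addr_0 mulr_natl.
    by rewrite size_rem// ss.
  have d0 : 0 <= d.+1%:R^-1 :> R by rewrite invr_ge0.
  move=> /(ler_wpM2l d0) /le_trans; apply.
  rewrite mulrA ler_wpM2r// mulrC ler_pdivrMr ?ltr0Sn// /rho mulrBl mul1r.
  rewrite -natr1 lerBrDr lerD2l mulrC ler_pdivrMr ?ltr0n// mul1r.
  by rewrite natr1 ler_nat.
have ub y : y \in u -> `|barycentre s - y| <= rho * r.
  apply: (@subdivide_closed (fun y => `|barycentre s - y| <= rho * r) d v) => //.
    by move=> w w0 wr; exact: barycentre_ball.
  by move=> z /sub_v; exact: sb.
have uu := IHd v u (ltnW dD) sv (fun x y xv yv => sr x y (sub_v _ xv) (sub_v _ yv)) uv.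
move=> x y; rewrite !inE => /predU1P[->|xu] /predU1P[->|yu].
- by rewrite subrr normr0 mulr_ge0.
- exact: ub.
- by rewrite distrC; exact: ub.
- exact: uu.
Qed.

Definition unit_vector (i : nat) : 'rV[R]_k := \row_j (j == i :> nat)%:R.

Definition signed_sum (eps : nat -> bool) x : R :=
  \sum_(j < k) (-1) ^+ eps j * x 0 j.

(** All vertices of a simplex of the octahedron lie on the facet cut out by
    one choice of signs, and this persists under subdivision. It keeps the
    vertices away from the origin. *)
Definition in_orthant_face (eps : nat -> bool) x : Prop :=
  `|x| <= 1 /\ signed_sum eps x = 1.

Lemma in_orthant_face_closed eps : barycentric_closed (in_orthant_face eps).
Proof.
move=> s s0 sQ; split.
  rewrite -normrN -sub0r; apply: barycentre_ball => // x /sQ[+ _].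
  by rewrite sub0r normrN.
have sumE : signed_sum eps (barycentre s) =
    (size s)%:R^-1 * \sum_(x <- s) signed_sum eps x.
  rewrite exchange_big mulr_sumr; apply: eq_bigr => j _.
  by rewrite mxE summxE mulrCA -mulr_sumr.
rewrite sumE big_seq (eq_bigr (fun=> 1)) => [|x /sQ[]//].
rewrite -big_seq big_const_seq count_predT iter_addr_0.
by rewrite -mulr_natl mulr1 mulVf// pnatr_eq0 size_eq0.
Qed.

(** A simplex never contains two opposite vertices, which is what the single
    choice of signs [eps] expresses. *)
Lemma octahedron_vertices d s : s \in octahedron -%R unit_vector d ->
  size s = d /\ exists eps : nat -> bool,
    {in s, forall x, exists2 i, (i < d)%N & x = (-1) ^+ eps i *: unit_vector i}.
Proof.
elim: d s => // d IHd s /mapP[u ud ->].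
have [su [eps ue]] : size u = d /\ exists eps : nat -> bool,
    {in u, forall x, exists2 i, (i < d)%N & x = (-1) ^+ eps i *: unit_vector i}.
  case: d IHd ud => [_|d IHd].
    by rewrite inE => /eqP ->; split=> //; exists (fun=> false).
  rewrite mem_cat => /orP[/IHd//|/mapP[v /IHd[sv [eps ve]] ->]].
  split; first by rewrite size_map.
  exists (fun i => ~~ eps i) => _ /mapP[x /ve[i id ->] ->]; exists i => //.
  by rewrite signrN scaleNr.
split; first by rewrite /= su.
exists (fun i => if i == d then false else eps i) => x.
rewrite inE => /predU1P[->|/ue[i id ->]].
  by exists d => //; rewrite eqxx scale1r.
by exists i; [exact: ltnW | rewrite ltn_eqF].
Qed.

Lemma octahedron_face d s : (d <= k)%N -> s \in octahedron -%R unit_vector d ->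
  exists eps, {in s, forall x, in_orthant_face eps x}.
Proof.
move=> dk /octahedron_vertices[_ [eps se]]; exists eps => x /se[i id ->]; split.
  rewrite normrZ normrX normrN1 expr1n mul1r; apply: norm_le_coord => // j.
  by rewrite mxE normr_nat; case: eqP.
rewrite /signed_sum (bigD1 (Ordinal (leq_trans id dk)))//= big1 => [|j ji].
  by rewrite addr0 !mxE eqxx mulr1 -signr_addb addbb.
rewrite !mxE; case: eqP => [e|_]; last by rewrite !mulr0.
by move/eqP: ji; case; exact: val_inj.
Qed.

Definition fine_octahedron N :=
  iter N (subdivide_chains barycentre) (octahedron -%R unit_vector).

Lemma fine_octahedron_size N d s : s \in fine_octahedron N d -> size s = d.
Proof.
elim: N s => [|N IHN] s; first by case/octahedron_vertices.
by case/flatten_mapP => t /IHN; exact: subdivide_size.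
Qed.

Lemma hemispheres_fine_octahedron N : hemispheres -%R (fine_octahedron N).
Proof.
elim: N => [|N IHN]; first by apply: hemispheres_octahedron; exact: opprK.
by apply: hemispheres_subdivide => //; [exact: barycentreN | exact: fine_octahedron_size].
Qed.

Lemma fine_octahedron_face N d s : (d <= k)%N -> s \in fine_octahedron N d ->
  exists eps, {in s, forall x, in_orthant_face eps x}.
Proof.
move=> dk; elim: N s => [|N IHN] s; first exact: octahedron_face.
case/flatten_mapP => t tN; have [eps te] := IHN t tN; exists eps.
exact: subdivide_closed (@in_orthant_face_closed eps) (fine_octahedron_size tN) te _.
Qed.

Lemma fine_octahedron_mesh N d s :
  (0 < k)%N -> (d <= k)%N -> s \in fine_octahedron N d ->
  mesh_le ((1 - k%:R^-1) ^+ N * 2) s.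
Proof.
move=> k0 dk; elim: N s => [|N IHN] s sN.
  have [eps se] := fine_octahedron_face dk sN.
  move=> x y /se[x1 _] /se[y1 _]; rewrite expr0 mul1r.
  by apply: le_trans (ler_normB _ _) _; rewrite (_ : 2 = 1 + 1)// lerD.
have rho0 : 0 <= 1 - k%:R^-1 :> R by rewrite subr_ge0 invf_le1 ?ler1n ?ltr0n.
case/flatten_mapP: sN => t tN; rewrite exprS -mulrA.
apply: subdivide_mesh dk (fine_octahedron_size tN) (IHN t tN) => //.
by rewrite mulr_ge0// exprn_ge0.
Qed.

End Barycentric.

(** * The Borsuk-Ulam theorem *)

Section BorsukUlam.
Variables (R : realType).

Lemma unit_sphere_coord s (y : 'rV[R]_s) : unit_sphere y ->
  exists i : 'I_s, 1 <= s%:R * y 0 i ^+ 2.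
Proof.
case: s y => [|s] y; rewrite /unit_sphere /=.
  by rewrite big_ord0 => /esym/eqP; rewrite oner_eq0.
move=> y1; pose i := [arg max_(j > ord0) `|y 0 j|]%O.
have imax j : `|y 0 j| <= `|y 0 i|.
  by rewrite /i; case: Order.TotalTheory.arg_maxP => // i0 _; exact.
exists i; apply: (@le_trans _ _ (\sum_(j < s.+1) y 0 j ^+ 2)).
  by rewrite y1.
apply: (@le_trans _ _ (\sum_(j < s.+1) y 0 i ^+ 2)).
  apply: ler_sum => j _; rewrite -[leLHS]real_normK ?num_real//.
  by rewrite -[leRHS]real_normK ?num_real// lerXn2r ?nnegrE.
by rewrite sumr_const card_ord mulr_natl.
Qed.

Lemma shell_compact k (a b : R) :
  compact [set y : 'rV[R]_k | a <= `|y| <= b].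
Proof.
apply: bounded_closed_compact.
  exists b; split; first exact: num_real.
  by move=> M bM y /= /andP[_ /le_trans]; apply; exact: ltW.
rewrite (_ : [set y | _] = (fun y : 'rV[R]_k => `|y|) @^-1` `[a, b]).
  apply: preimage_closed => [y _|]; last exact: interval_closed.
  exact: norm_continuous.
by apply/seteqP; split => y; rewrite /= in_itv.
Qed.

(** Heine-Cantor, with the second point allowed to leave the compact set. *)
Lemma compact_uniform k s (h : 'rV[R]_k -> 'rV[R]_s) (K : set 'rV[R]_k) (e : R) :
  compact K -> (forall y, K y -> {for y, continuous h}) -> 0 < e ->
  exists2 d, 0 < d & forall x y, K x -> `|x - y| < d ->
    forall i, `|h x 0 i - h y 0 i| < e.
Proof.
move=> /compact_near_coveringP cK hc e0.
pose P d x := forall y, `|x - y| < d -> forall i, `|h x 0 i - h y 0 i| < e.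
have near_P : \forall d \near (0 : R)^'+, K `<=` P d.
  apply: cK => x Kx.
  have /cvgrPdist_lt/(_ (e / 2)) := hc x Kx.
  rewrite divr_gt0// => /(_ isT)/nbhs_ballP[r /= r0 rh].
  exists (ball x (r / 2), [set d | 0 < d < r / 2]) => /=.
    split; first by apply: nbhsx_ballx; rewrite divr_gt0.
    near=> d; apply/andP; split=> //; near: d; apply: nbhs_right_lt.
    by rewrite divr_gt0.
  move=> [x' d] /= [xx' /andP[d0 dr]] y x'y i.
  have hx z : ball x r z -> `|h x 0 i - h z 0 i| < e / 2.
    move=> /rh; apply: le_lt_trans.
    by have := coord_le_norm (h x - h z) i; rewrite !mxE.
  have b1 : ball x r x'.
    by apply: le_ball xx'; rewrite ler_pdivrMr// ler_pMr// ler1n.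
  have b2 : ball x r y.
    rewrite (splitr r); apply: ball_triangle xx' _.
    by rewrite -ball_normE /=; exact: lt_trans dr.
  rewrite (splitr e) -(subrKA (h x 0 i)); apply: le_lt_trans (ler_normD _ _) _.
  by rewrite ltrD// ?hx// distrC hx.
have [d [dK d0]] : exists d, K `<=` P d /\ 0 < d.
  apply: (@filter_ex _ (0 : R)^'+); apply: filterI near_P _.
  exact: nbhs_right_gt.
by exists d => // x y /dK; apply.
Unshelve. all: by end_near.
Qed.

(** Label [y] by a coordinate where [h y] is largest in absolute value, with
    the sign of that coordinate. This coordinate is bounded away from zero, so
    on a sufficiently fine subdivision no edge is complementary, and an
    alternating simplex with [s + 1] vertices cannot exist for want of labels. *)
Theorem borsuk_ulam k s (h : 'rV[R]_k -> 'rV[R]_s) :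
  (forall y : 'rV[R]_k, y != 0 -> {for y, continuous h}) ->
  (forall y : 'rV[R]_k, y != 0 -> h (- y) = - h y) ->
  (forall y : 'rV[R]_k, y != 0 -> unit_sphere (h y)) -> (k <= s)%N.
Proof.
move=> hc hN h1; rewrite leqNgt; apply/negP => sk.
have k0 : (0 < k)%N by exact: leq_ltn_trans sk.
pose K := [set y : 'rV[R]_k | k%:R^-1 <= `|y| <= 1].
have Kneq0 y : K y -> y != 0.
  move=> /andP[ky _]; rewrite -normr_gt0; apply: lt_le_trans ky.
  by rewrite invr_gt0 ltr0n.
have faceK eps y : in_orthant_face eps y -> K y.
  move=> [y1 ye]; rewrite /K /= y1 andbT -[leLHS]mul1r ler_pdivrMr ?ltr0n//.
  rewrite -{1}ye; apply: (@le_trans _ _ (\sum_(j < k) `|y|)).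
    apply: ler_sum => j _; apply: le_trans (coord_le_norm y j).
    by apply: le_trans (ler_norm _) _; rewrite normrM normrX normrN1 expr1n mul1r.
  by rewrite sumr_const card_ord mulr_natr.
have s0 : (0 < s)%N.
  pose y0 : 'rV[R]_k := const_mx 1.
  have /h1/unit_sphere_coord[[i i_lt] _] : y0 != 0; last exact: leq_ltn_trans i_lt.
  by apply/eqP => /matrixP/(_ 0 (Ordinal k0))/eqP; rewrite !mxE oner_eq0.
pose top y : 'I_s := [arg max_(j > Ordinal s0) `|h y 0 j|]%O.
have topP y j : `|h y 0 j| <= `|h y 0 (top y)|.
  by rewrite /top; case: Order.TotalTheory.arg_maxP => // i0 _; exact.
have top1 y : y != 0 -> s%:R^-1 <= h y 0 (top y) ^+ 2.
  move=> /h1/unit_sphere_coord[i si].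
  rewrite -[leLHS]mul1r ler_pdivrMr ?ltr0n// mulrC; apply: le_trans si _.
  rewrite ler_pM2l ?ltr0n// -real_normK ?num_real// -[leRHS]real_normK ?num_real//.
  by rewrite lerXn2r ?nnegrE.
have sV0 : 0 < s%:R^-1 :> R by rewrite invr_gt0 ltr0n.
have cK : compact K by exact: shell_compact.
have [d d0 dK] := compact_uniform cK
  (fun y Ky => hc y (Kneq0 y Ky)) sV0.
(* The number of subdivisions which brings the initial diameter 2 below [d]. *)
have [N Nd] : exists N, (1 - k%:R^-1) ^+ N * 2 < d.
  have : (geometric 2 (1 - k%:R^-1)) @ \oo --> (0 : R).
    apply: cvg_geometric; rewrite ger0_norm.
      by rewrite ltrBlDr ltrDl invr_gt0 ltr0n.
    by rewrite subr_ge0 invf_le1 ?ler1n ?ltr0n.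
  move=> /cvgrPdist_lt/(_ d d0)[N _ /(_ N (leqnn N)) NH]; exists N.
  move: NH; rewrite /geometric /= sub0r normrN mulrC; apply: le_lt_trans.
  exact: ler_norm.
pose code y := ((0 < h y 0 (top y))%R + (top y).*2)%N.
have half_code y : (code y)./2 = top y :> nat.
  by rewrite /code half_bit_double.
have codeP m t : (m <= s.+1)%N -> t \in fine_octahedron R k N m ->
    {in t, forall x, code (- x) = flip (code x)} /\
    non_complementary (map code t).
  move=> ms tm.
  have mk : (m <= k)%N by exact: leq_trans ms sk.
  have [eps te] := fine_octahedron_face mk tm.
  have tK y : y \in t -> K y by move=> /te; exact: faceK.
  have mesh := fine_octahedron_mesh k0 mk tm.
  split=> [y yt|].
    have y0 := Kneq0 y (tK y yt).
    have topN : top (- y) = top y.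
      rewrite /top (_ : (fun j => `|h (- y) 0 j|) = fun j => `|h y 0 j|)//.
      by apply/funext => j; rewrite hN// mxE normrN.
    rewrite /code topN hN// mxE oppr_gt0 /flip oddD odd_double oddb /=.
    have : h y 0 (top y) != 0.
      by apply: contraTneq (top1 y y0) => ->; rewrite expr0n -ltNge.
    by case: ltgtP => //= _ _; rewrite ?addn0 ?addn1.
  move=> _ _ /mapP[x xt ->] /mapP[y yt ->]; rewrite !half_code /code.
  move=> /ord_inj xy; rewrite -xy; congr (_ + _)%N; congr nat_of_bool.
  have {}mesh : `|h x 0 (top x) - h y 0 (top x)| < s%:R^-1.
    apply: dK; first exact: tK.
    apply: le_lt_trans (mesh x y xt yt) _; exact: Nd.
  have x1 := top1 _ (Kneq0 _ (tK x xt)); have := top1 _ (Kneq0 _ (tK y yt)).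
  have s1 : s%:R^-1 <= 1 :> R by rewrite invf_le1 ?ler1n ?ltr0n.
  rewrite -xy => y1; move: x1 y1 mesh s1 sV0.
  move: (h x 0 _) (h y 0 _) (s%:R^-1) => u v r; rewrite ltr_norml.
  by case: (ltP 0 u) => u0; case: (ltP 0 v) => v0 //; nra.
have [t tN [b bt]] : exists2 t, t \in fine_octahedron R k N s.+1 &
    exists b, fan b (map code t).
  apply: (@exists_alternating_simplex _ -%R) => [|m t ms].
    exact: hemispheres_fine_octahedron.
  exact: codeP (leqW ms).
have [_ nc] := codeP _ _ (leqnn _) tN.
suff : (size (map code t) <= s)%N.
  by rewrite size_map (fine_octahedron_size tN) ltnn.
apply: fan_size nc _ bt => c /mapP[x _ ->].
by rewrite half_code.
Qed.

End BorsukUlam.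

(** * Convex functions, subgradients and the Clarke subdifferential *)

Section ConvexFunctions.
Variable R : realType.

Definition convex_fun (V : lmodType R) (f : V -> R) : Prop :=
  forall (t : R) x y, 0 <= t <= 1 ->
    f (t *: x + (1 - t) *: y) <= t * f x + (1 - t) * f y.

(** Partial minimization preserves convexity. Finiteness of the infimum also
    follows from convexity, by comparing [J v w] with [J (- v) 0] through the
    midpoint. *)
Lemma inf_marginal (V W : lmodType R) (J : V -> W -> R) :
  (forall (t : R) x y w z, 0 <= t <= 1 ->
    J (t *: x + (1 - t) *: y) (t *: w + (1 - t) *: z) <=
    t * J x w + (1 - t) * J y z) ->
  (forall w, 0 <= J 0 w) -> J 0 0 = 0 ->
  exists N : V -> R, [/\ convex_fun N, N 0 = 0, forall v w, N v <= J v w &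
    forall v m, (forall w, m <= J v w) -> m <= N v].
Proof.
move=> Jc J0_ge0 J00.
have Jlb v w : - J (- v) 0 <= J v w.
  have half01 : 0 <= (2^-1 : R) <= 1 by lra.
  have := Jc _ v (- v) w 0 half01.
  have -> : 1 - 2^-1 = 2^-1 :> R by lra.
  rewrite -(scalerDr _ v) subrr !scaler0 addr0.
  by have := J0_ge0 (2^-1 *: w); lra.
have lb v : has_lbound (range (J v)).
  by exists (- J (- v) 0) => _ [w _ <-].
have ne v : range (J v) !=set0 by exists (J v 0); exists 0.
pose N v := inf (range (J v)).
have NJ v w : N v <= J v w by apply: ge_inf => //; exists w.
have leN v m : (forall w, m <= J v w) -> m <= N v.
  by move=> mJ; apply: lb_le_inf => // _ [w _ <-].
exists N; split=> //.
  move=> t x y t01; apply/ler_addgt0Pr => e e0.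
  have [_ [w _ <-] wx] := inf_adherent e0 (conj (ne x) (lb x)).
  have [_ [z _ <-] zy] := inf_adherent e0 (conj (ne y) (lb y)).
  apply: le_trans (NJ _ (t *: w + (1 - t) *: z)) _.
  apply: le_trans (Jc _ _ _ _ _ t01) _.
  by move: wx zy; rewrite -/(N x) -/(N y); nra.
apply/eqP; rewrite eq_le leN// andbT.
by rewrite -[leRHS]J00.
Qed.

(** Slopes of chords to the left of zero are below those to the right; the
    infimum of the latter is a subgradient. *)
Lemma line_subgradient (g : R -> R) : convex_fun (g : R^o -> R) -> g 0 = 0 ->
  exists a, forall t, a * t <= g t.
Proof.
move=> gc g0; pose E := [set g t / t | t in [set t | 0 < t]].
have slopes s t : 0 < s -> 0 < t -> - g (- s) / s <= g t / t.
  move=> s0 t0; have st0 : 0 < s + t by lra.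
  have w01 : 0 <= s / (s + t) <= 1.
    apply/andP; split; first by apply: divr_ge0; lra.
    by rewrite ler_pdivrMr// mul1r; lra.
  have := gc _ t (- s) w01; have -> : 1 - s / (s + t) = t / (s + t) by field; lra.
  rewrite (_ : _ *: _ + _ = 0); last by rewrite /GRing.scale /=; field; lra.
  have -> : s / (s + t) * g t + t / (s + t) * g (- s) =
    (s * t / (s + t)) * (g t / t - - g (- s) / s) by field; lra.
  by rewrite g0 pmulr_rge0 ?subr_ge0// divr_gt0// mulr_gt0.
have lbE s : 0 < s -> lbound E (- g (- s) / s).
  by move=> s0 _ [t t0 <-]; exact: slopes.
exists (inf E) => t; have [t0|t0|->] := ltgtP t 0; last by rewrite g0 mulr0.
  have s0 : 0 < - t by lra.
  have : - g t / - t <= inf E.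
    apply: lb_le_inf; first by exists (g 1 / 1), 1 => //=; exact: ltr01.
    by rewrite -{1}(opprK t); exact: lbE.
  by rewrite ler_pdivrMr//; lra.
rewrite -ler_pdivlMr//; apply: ge_inf; last by exists t.
by exists (- g (- 1) / 1); exact: lbE.
Qed.

(** One step of the Hahn-Banach theorem: [N'] is the infimum of
    [N (v + t u) - a t] over [t], for a subgradient [a] along [u]. Directions
    along which [N] is already affine keep this property, so the step can be
    repeated over a basis. *)
Lemma linearize_along (V : lmodType R) (N : V -> R) (u : V) :
  convex_fun N -> N 0 = 0 ->
  exists a (N' : V -> R), [/\ convex_fun N', N' 0 = 0, forall v, N' v <= N v,
    forall v s, N' (v + s *: u) = N' v + a * s &
    forall u' b, (forall v s, N (v + s *: u') = N v + b * s) ->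
                 (forall v s, N' (v + s *: u') = N' v + b * s)].
Proof.
move=> Nc N0; have [||a ga] := @line_subgradient (fun t => N (t *: u)).
- move=> t x y t01 /=.
  rewrite (_ : _ *: u = t *: (x *: u) + (1 - t) *: (y *: u)); first exact: Nc.
  by rewrite !scalerA -scalerDl.
- by rewrite scale0r N0.
pose J v (t : R^o) := N (v + t *: u) - a * t.
have [|||N' [N'c N'0 N'J leN']] := @inf_marginal V R^o J.
- move=> t x y w z t01; rewrite /J.
  have -> : t *: x + (1 - t) *: y + (t *: w + (1 - t) *: z) *: u =
      t *: (x + w *: u) + (1 - t) *: (y + z *: u).
    by rewrite !scalerDr !scalerA [RHS]addrACA -[in RHS]scalerDl.
  by have := Nc t (x + w *: u) (y + z *: u) t01; rewrite /GRing.scale /=; lra.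
- by move=> w; rewrite /J add0r subr_ge0.
- by rewrite /J scale0r addr0 N0 mulr0 subr0.
exists a, N'; have half u' b : (forall v s, N' v + b * s <= N' (v + s *: u')) ->
    forall v s, N' (v + s *: u') = N' v + b * s.
  move=> le v s; apply/eqP; rewrite eq_le le andbT.
  have := le (v + s *: u') (- s).
  by rewrite scaleNr addrK; lra.
split=> //.
- by move=> v; apply: le_trans (N'J v 0) _; rewrite /J scale0r addr0 mulr0 subr0.
- apply: half => v s; apply: leN' => t; have := N'J v (s + t).
  by rewrite /J scalerDl addrA; lra.
- move=> u' b lin; apply: half => v s; apply: leN' => t; have := N'J v t.
  by rewrite /J addrAC lin; lra.
Qed.

Lemma convex_subgradient n (N : 'rV[R]_n -> R) : convex_fun N -> N 0 = 0 ->
  exists xi, forall v, dotrv xi v <= N v.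
Proof.
move=> Nc N0; pose e (j : 'I_n) : 'rV[R]_n := delta_mx 0 j.
have [b [N' [N'0 N'N lin]]] : exists (b : 'I_n -> R) (N' : 'rV[R]_n -> R),
    [/\ N' 0 = 0, forall v, N' v <= N v &
     forall i, i \in enum 'I_n -> forall v s, N' (v + s *: e i) = N' v + b i * s].
  suff [b [N' [_ *]]] : exists (b : 'I_n -> R) (N' : 'rV[R]_n -> R),
      [/\ convex_fun N', N' 0 = 0, forall v, N' v <= N v &
       forall i, i \in enum 'I_n -> forall v s, N' (v + s *: e i) = N' v + b i * s].
    by exists b, N'.
  elim: (enum _) => [|i r [b [N1 [N1c N10 N1N lin]]]]; first by exists (fun=> 0), N.
  have [a [N' [N'c N'0 N'N1 lini linr]]] := linearize_along (e i) N1c N10.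
  exists (fun j => if j == i then a else b j), N'; split=> //.
    by move=> v; exact: le_trans (N'N1 v) (N1N v).
  move=> j; rewrite inE; case: eqVneq => [-> _|_ /= jr]; first exact: lini.
  exact/linr/lin.
exists (\row_i b i) => v; apply: le_trans (N'N v).
have N'E (r : seq 'I_n) :
    N' (\sum_(i <- r) v 0 i *: e i) = \sum_(i <- r) b i * v 0 i.
  elim: r => [|i r IHr]; first by rewrite !big_nil.
  by rewrite !big_cons addrC lin ?mem_enum// IHr addrC.
rewrite [in leRHS](row_sum_delta v) N'E /dotrv.
by apply: ler_sum => i _; rewrite mxE.
Qed.

Lemma convex_translate (V : lmodType R) (f : V -> R) x : convex_fun f ->
  convex_fun (fun v => f (x + v) - f x).
Proof.
move=> fc t y z t01; have := fc t (x + y) (x + z) t01.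
have -> : t *: (x + y) + (1 - t) *: (x + z) = x + (t *: y + (1 - t) *: z).
  by rewrite !scalerDr addrACA -scalerDl subrKC scale1r.
by lra.
Qed.

(** A subgradient at zero of the infimal convolution of [f] and [g] lies below
    both functions, since each of them is zero at zero. *)
Lemma convex_sandwich n (f g : 'rV[R]_n -> R) : convex_fun f -> convex_fun g ->
  f 0 = 0 -> g 0 = 0 -> (forall v, 0 <= f v + g (- v)) ->
  exists xi, forall v, dotrv xi v <= f v /\ dotrv xi v <= g v.
Proof.
move=> fc gc f0 g0 fg.
pose J (v w : 'rV[R]_n) := f (v + w) + g (- w).
have [|||N [Nc N0 NJ _]] := @inf_marginal _ _ J.
- move=> t x y w z t01; rewrite /J.
  have -> : t *: x + (1 - t) *: y + (t *: w + (1 - t) *: z) =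
      t *: (x + w) + (1 - t) *: (y + z) by rewrite !scalerDr addrACA.
  have -> : - (t *: w + (1 - t) *: z) = t *: - w + (1 - t) *: - z.
    by rewrite !scalerN opprD.
  have := fc t (x + w) (y + z) t01; have := gc t (- w) (- z) t01; lra.
- by move=> w; rewrite /J add0r.
- by rewrite /J oppr0 addr0 f0 g0 addr0.
have [xi xiN] := convex_subgradient Nc N0.
exists xi => v; split; apply: le_trans (xiN v) _.
  by have := NJ v 0; rewrite /J oppr0 addr0 g0 addr0.
by have := NJ v (- v); rewrite /J subrr opprK f0 add0r.
Qed.

Lemma convex_chord (V : lmodType R) (f : V -> R) x v t : convex_fun f ->
  0 <= t <= 1 -> f (x + t *: v) - f x <= t * (f (x + v) - f x).
Proof.
move=> fc t01; have := fc t (x + v) x t01.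
have -> : t *: (x + v) + (1 - t) *: x = x + t *: v.
  by rewrite scalerDr addrAC -scalerDl subrKC scale1r.
by lra.
Qed.

Lemma dotrvZr n (xi v : 'rV[R]_n) t : dotrv xi (t *: v) = t * dotrv xi v.
Proof.
by rewrite /dotrv mulr_sumr; apply: eq_bigr => i _; rewrite mxE mulrCA.
Qed.

Lemma dotrvZl n (xi v : 'rV[R]_n) t : dotrv (t *: xi) v = t * dotrv xi v.
Proof.
by rewrite /dotrv mulr_sumr; apply: eq_bigr => i _; rewrite mxE mulrA.
Qed.

(** Difference quotients of a convex function increase with the step. Hence
    the generalized directional derivative is bounded above by increments of
    the unit step from points near [x]; conversely each neighbourhood in its
    definition contains quotients based at [x] itself, which a subgradient
    bounds below. *)
Lemma clarke_subdiff_convex n (f : 'rV[R]_n -> R) x :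
  convex_fun f -> continuous f ->
  clarke_subdiff f x = [set xi | forall v, dotrv xi v <= f (x + v) - f x].
Proof.
move=> fc fcont; apply/seteqP; split => xi /= H v.
  apply/ler_addgt0Pr => e e0; rewrite -lee_fin.
  apply: le_trans (H v) _; rewrite /clarke_dir limf_esupE.
  have : {for x, continuous (fun y : 'rV[R]_n => f (y + v) - f y)}.
    apply: (@continuousB R R^o); last exact: fcont.
    apply: continuous_comp; last exact: fcont.
    by apply: continuousD; [exact: cvg_id | exact: cst_continuous].
  move=> /cvgrPdist_lt/(_ e e0) near_e.
  apply: ge_ereal_inf.
  exists (ereal_sup [set ((f (yt.1 + yt.2 *: v) - f yt.1) / yt.2)%:E | yt in
    [set y | `|f (x + v) - f x - (f (y + v) - f y)| < e] `*` [set t | 0 < t <= 1]]).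
    exists ([set y | `|f (x + v) - f x - (f (y + v) - f y)| < e] `*`
            [set t | 0 < t <= 1]) => //.
    exists ([set y | `|f (x + v) - f x - (f (y + v) - f y)| < e], [set t | 0 < t <= 1]) => //.
    split=> //=; near=> t; apply/andP; split=> //.
    by near: t; apply: nbhs_right_le; exact: ltr01.
  apply: ge_ereal_sup => _ [[y t] [/= ye /andP[t0 t1]] <-].
  rewrite lee_fin ler_pdivrMr//.
  have t01 : 0 <= t <= 1 by rewrite ltW.
  apply: le_trans (convex_chord y v fc t01) _.
  rewrite mulrC ler_pM2r//; move: ye; rewrite ltr_norml; lra.
rewrite /clarke_dir limf_esupE; apply: le_ereal_inf_tmp => _ [A [[P Q] /= [xP Q0] PQA] <-].
have [t [Qt t0]] : exists t, Q t /\ 0 < t.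
  by apply: (@filter_ex _ (0 : R)^'+); apply: filterI => //; exact: nbhs_right_gt.
apply: le_ereal_sup_tmp; exists ((f (x + t *: v) - f x) / t)%:E.
  by exists (x, t) => //; apply: PQA; split => //=; exact: nbhs_singleton.
rewrite lee_fin ler_pdivlMr// mulrC -dotrvZr; exact: H.
Unshelve. all: by end_near.
Qed.

End ConvexFunctions.

(** * Odd maps into spheres and the genus *)

Section OddMaps.
Variable R : realType.

Lemma cvg_row (T : Type) (F : set_system T) {FF : Filter F} s
    (f : T -> 'rV[R]_s) (l : 'rV[R]_s) :
  (forall j, f x 0 j @[x --> F] --> l 0 j) -> f x @[x --> F] --> l.
Proof.
move=> fl; apply/cvgrPdist_lt => e e0.
have e20 : 0 < e / 2 by rewrite divr_gt0.
have : \forall x \near F, forall j, `|l 0 j - f x 0 j| < e / 2.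
  by apply: filter_forall => j; have /cvgrPdist_lt/(_ _ e20) := fl j.
apply: filterS => x xl; apply: (@le_lt_trans _ _ (e / 2)).
  apply: norm_le_coord => [|j]; first exact: ltW.
  by rewrite !mxE; exact: ltW.
by rewrite ltr_pdivrMr// ltr_pMr// ltr1n.
Qed.

Lemma continuous_coord (T : topologicalType) s (f : T -> 'rV[R]_s) x j :
  {for x, continuous f} -> {for x, continuous (fun y => f y 0 j)}.
Proof.
move=> cf; apply: (@continuous_comp _ _ _ f (fun M : 'rV[R]_s => M 0 j)) => //.
exact: coord_continuous.
Qed.

Definition euclid_norm s (y : 'rV[R]_s) : R := Num.sqrt (\sum_(j < s) y 0 j ^+ 2).

Lemma euclid_norm_gt0 s (y : 'rV[R]_s) : y != 0 -> 0 < euclid_norm y.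
Proof.
move=> y0; rewrite sqrtr_gt0 lt0r sumr_ge0 ?andbT => [|j _]; last exact: sqr_ge0.
apply: contra_neq y0 => y0; apply/rowP => j; rewrite mxE.
have /eqP : y 0 j ^+ 2 = 0.
  by apply: (psumr_eq0P _ y0) => // i _; exact: sqr_ge0.
by rewrite sqrf_eq0 => /eqP.
Qed.

Lemma euclid_normN s (y : 'rV[R]_s) : euclid_norm (- y) = euclid_norm y.
Proof.
by congr Num.sqrt; apply: eq_bigr => j _; rewrite mxE sqrrN.
Qed.

Lemma unit_sphere_normalize s (y : 'rV[R]_s) : y != 0 ->
  unit_sphere ((euclid_norm y)^-1 *: y).
Proof.
move=> y0; rewrite /unit_sphere /=.
under eq_bigr do rewrite mxE exprMn.
rewrite -mulr_sumr -[X in _ * X]sqr_sqrtr; last first.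
  by apply: sumr_ge0 => j _; exact: sqr_ge0.
by rewrite -/(euclid_norm y) -exprMn mulVf ?expr1n// gt_eqF// euclid_norm_gt0.
Qed.

Lemma unit_sphere_neq0 s (y : 'rV[R]_s) : unit_sphere y -> y != 0.
Proof.
apply: contraPneq => ->; rewrite /unit_sphere /= big1 => [/esym/eqP|j _].
  by rewrite oner_eq0.
by rewrite mxE expr0n.
Qed.

Lemma continuous_sum (T : topologicalType) (I : Type) (r : seq I) (P : pred I)
    (f : I -> T -> R) x :
  (forall i, P i -> {for x, continuous (f i)}) ->
  {for x, continuous (fun y => \sum_(i <- r | P i) f i y)}.
Proof.
by move=> cf; apply: (@cvg_big R _ +%R) => //; exact: add_continuous.
Qed.

Lemma euclid_norm_continuous s (T : topologicalType) (f : T -> 'rV[R]_s) x :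
  {for x, continuous f} -> {for x, continuous (fun y => euclid_norm (f y))}.
Proof.
move=> cf; apply: (@continuous_comp _ _ _ (fun y => \sum_(j < s) f y 0 j ^+ 2)).
  apply: continuous_sum => j _.
  have cj : {for x, continuous (fun y => f y 0 j)} by exact: continuous_coord.
  exact: (continuousM cj cj).
exact: sqrt_continuous.
Qed.

Lemma normalize_continuous (T : topologicalType) s (f : T -> 'rV[R]_s) x :
  {for x, continuous f} -> f x != 0 ->
  {for x, continuous (fun y => (euclid_norm (f y))^-1 *: f y)}.
Proof.
move=> cf fx0; apply: continuousZ => //.
apply: continuousV; first by rewrite gt_eqF// euclid_norm_gt0.
exact: euclid_norm_continuous.
Qed.

(** Normalizing removes the need to land exactly on the sphere. *)
Lemma odd_sphere_mapI n (A : set 'rV[R]_n) s (h : 'rV[R]_n -> 'rV[R]_s) :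
  (forall x, A x -> {for x, continuous h}) ->
  (forall x, A x -> h (- x) = - h x) -> (forall x, A x -> h x != 0) ->
  odd_sphere_map A s.
Proof.
move=> hc hN h0; exists (fun x => (euclid_norm (h x))^-1 *: h x); split.
- apply: continuous_in_subspaceT => x /[!inE] Ax.
  by apply: normalize_continuous; [exact: hc | exact: h0].
- by move=> x Ax; rewrite hN// euclid_normN scalerN.
- by move=> x Ax; apply: unit_sphere_normalize; exact: h0.
Qed.

Lemma unit_sphere_coord_le1 s (y : 'rV[R]_s) j : unit_sphere y -> `|y 0 j| <= 1.
Proof.
move=> y1; rewrite -(@ler_pXn2r _ 2) ?nnegrE// expr1n real_normK ?num_real//.
rewrite -[leRHS]y1 (bigD1 j)//= lerDl.
by apply: sumr_ge0 => i _; exact: sqr_ge0.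
Qed.

(** Tietze's theorem in each coordinate, followed by taking the odd part. The
    extension may have zeros away from [A]. *)
Lemma odd_extension n (A : set 'rV[R]_n) s : closed A -> symmetric_set A ->
  odd_sphere_map A s -> exists h : 'rV[R]_n -> 'rV[R]_s,
    [/\ continuous h, forall x, h (- x) = - h x & forall x, A x -> unit_sphere (h x)].
Proof.
move=> cA sA [f [fc fN f1]].
have ext j : exists g : 'rV[R]_n -> R,
    continuous g /\ forall x, A x -> g x = f x 0 j.
  have [|||g [fg gc _]] := @continuous_bounded_extension 'rV[R]_n R
    (@pseudometric_normal _ _) A cA (fun x => f x 0 j) 1.
  - exact: ltr01.
  - by move=> x; apply: continuous_coord; exact: fc.
  - by move=> x Ax; apply: unit_sphere_coord_le1; exact: f1.
  by exists g; split=> // x Ax; rewrite fg// inE.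
have {ext} [g gP] := choice ext.
pose h x : 'rV[R]_s := \row_j ((g j x - g j (- x)) / 2).
have hf x : A x -> h x = f x.
  move=> Ax; apply/rowP => j; rewrite mxE (gP j).2// (gP j).2; last exact: sA.
  by rewrite fN// mxE; lra.
exists h; split=> [x|x|x Ax]; last by rewrite hf//; exact: f1.
  apply: (@cvg_row _ (nbhs x) (nbhs_filter x)) => j; rewrite mxE; under eq_fun do rewrite mxE.
  have gN : {for x, continuous (fun y : 'rV[R]_n => g j (- y))}.
    apply: (@continuous_comp 'rV[R]_n 'rV[R]_n R (fun y => - y) (g j)); last exact: (gP j).1.
    exact: oppr_continuous.
  apply: cvgM; last exact: cvg_cst.
  by apply: (@cvgB R R^o) => //; exact: (gP j).1.
by apply/rowP => j; rewrite !mxE opprK; lra.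
Qed.

Lemma genus_ge n (A : set 'rV[R]_n) (i : nat) :
  ((i%:R : R)%:E <= genus A)%E <-> forall s, odd_sphere_map A s -> (i <= s)%N.
Proof.
split=> [iA s As|iA].
  rewrite -(@ler_nat R) -lee_fin; apply: le_trans iA _.
  by apply: ereal_inf_lbound; exists s.
by apply: le_ereal_inf_tmp => _ [s As <-]; rewrite lee_fin ler_nat; exact: iA.
Qed.

Lemma genus_eq n (A : set 'rV[R]_n) (r : nat) :
  genus A = (r%:R : R)%:E -> exists2 s, (s <= r)%N & odd_sphere_map A s.
Proof.
move=> Ar; have : (genus A < (r.+1%:R : R)%:E)%E by rewrite Ar lte_fin ltr_nat.
move=> /ereal_inf_lt[_ [s As <-]]; rewrite lte_fin ltr_nat ltnS => sr.
by exists s.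
Qed.

Lemma genus_lt n (A : set 'rV[R]_n) (i : nat) :
  ~ ((i%:R : R)%:E <= genus A)%E -> exists2 s, (s < i)%N & odd_sphere_map A s.
Proof.
move=> /negP; rewrite -ltNge => /ereal_inf_lt[_ [s As <-]].
by rewrite lte_fin ltr_nat => si; exists s.
Qed.

Lemma odd_sphere_map_sub n (A B : set 'rV[R]_n) s : A `<=` B ->
  odd_sphere_map B s -> odd_sphere_map A s.
Proof.
move=> AB [f [fc fN f1]]; exists f; split=> [|x /AB|x /AB]; last 2 first.
- exact: fN.
- exact: f1.
exact: continuous_subspaceW AB fc.
Qed.

End OddMaps.

(** * Deformation and the multiplicity theorem *)

(** Properties of sets which are stable under finite unions and hold locally
    hold for a set covering a compact one. The filter of large good sets turns
    compactness in its near-covering form into the extraction of a finite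
    cover. *)
Lemma compact_induction (T : topologicalType) (K : set T) (P : set T -> Prop) :
  compact K -> P set0 -> (forall A B, P A -> P B -> P (A `|` B)) ->
  (forall x, K x -> exists2 U, nbhs x U & P U) -> exists2 W, P W & K `<=` W.
Proof.
move=> /compact_near_coveringP cK P0 PU Ploc.
pose upper (W : set T) : set (set T) := [set V | P V /\ W `<=` V].
pose FP : set_system (set T) := filter_from P upper.
have FF : Filter FP.
  apply: filter_from_filter; first by exists set0.
  move=> A B PA PB; exists (A `|` B); first exact: PU.
  by move=> V [PV ABV]; split; split=> // x ?; apply: ABV; [left|right].
have := cK _ FP (fun V x => V x) FF.
move=> [x /Ploc[U xU UP]|W PW KW].
  exists (U, upper U); first by split=> //; exists U.
  by move=> [y V] [/= Uy [_]]; exact.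
by exists W => //; apply: (KW W); split.
Qed.

Section Descent.
Variables (R : realType) (n : nat) (F G : 'rV[R]_n -> R) (c : R).
Hypotheses (Fconv : convex_fun F) (Gconv : convex_fun G).
Hypotheses (Fcont : continuous F) (Gcont : continuous G).
Hypothesis FN : forall x : 'rV[R]_n, F (- x) = F x.
Hypothesis GN : forall x : 'rV[R]_n, G (- x) = G x.
Hypothesis c_ge0 : 0 <= c.

Let H (y : 'rV[R]_n) : R := F y - c * G y.

(** For [c >= 0] and convex [F] and [G], an upper bound for the one-sided
    slope of [F - c G] at [x] in the direction [v]: the backward increment of
    [G] takes care of the term which enters with a negative sign. *)
Definition slope_bound (x v : 'rV[R]_n) : R := F (x + v) - F x + c * (G (x - v) - G x).

Definition critical (x : 'rV[R]_n) : Prop := forall v, 0 <= slope_bound x v.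

Lemma level_continuous : continuous H.
Proof.
move=> x; apply: (@continuousB R R^o _ F (fun y => c * G y)); first exact: Fcont.
by apply: continuousM; [exact: cst_continuous | exact: Gcont].
Qed.

Lemma shift_continuous (f : 'rV[R]_n -> R) v : continuous f ->
  continuous (fun x : 'rV[R]_n => f (x + v) - f x).
Proof.
move=> fc x; apply: (@continuousB R R^o); last exact: fc.
apply: continuous_comp; last exact: fc.
by apply: continuousD; [exact: cvg_id | exact: cst_continuous].
Qed.

(** Chords bound the increment of [F] from [y] and the backward increment of
    [G] from [y + t v] by [t] times the increments of a unit step, and
    continuity keeps the sum of the latter negative near [x]. *)
Lemma local_descent x v : slope_bound x v < 0 ->
  exists rho, 0 < rho /\ exists tau, 0 < tau /\
    forall y t, ball x rho y -> 0 < t <= tau -> H (y + t *: v) < H y.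
Proof.
set b := slope_bound x v => b0.
have c10 : 0 < c + 1 by exact: ltr_wpDl.
(* The errors in [F] and in [c G] then add up to half of the margin [- b]. *)
pose e := - b / 2 / (c + 1); have e0 : 0 < e by rewrite !divr_gt0// oppr_gt0.
have /cvgrPdist_lt/(_ e e0)/nbhs_ballP[r1 /= r10 Fr] := @shift_continuous F v Fcont x.
have /cvgrPdist_lt/(_ e e0)/nbhs_ballP[r2 /= r20 Gr] := @shift_continuous G (- v) Gcont x.
pose r := Num.min r1 r2; have r0 : 0 < r by rewrite lt_min r10.
have vn : 0 < `|v| + 1 by apply: ltr_wpDl.
exists (r / 2); split; first by rewrite divr_gt0.
exists (Num.min 1 (r / 2 / (`|v| + 1))).
split; first by rewrite lt_min ltr01 !divr_gt0.
move=> y t xy /andP[t0]; rewrite le_min => /andP[t1 tr].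
have xr1 z : ball x r z -> ball x r1 z by apply: le_ball; rewrite ge_min lexx.
have xr2 z : ball x r z -> ball x r2 z by apply: le_ball; rewrite ge_min lexx orbT.
have xyr : ball x r y by apply: le_ball xy; rewrite ler_pdivrMr// ler_pMr// ler1n.
have xzr : ball x r (y + t *: v).
  rewrite (splitr r); apply: ball_triangle xy _; rewrite -ball_normE /=.
  rewrite opprD addrA subrr sub0r normrN normrZ (gtr0_norm t0).
  apply: (@lt_le_trans _ _ (t * (`|v| + 1))); first by rewrite ltr_pM2l// ltrDl.
  by rewrite -ler_pdivlMr.
have t01 : 0 <= t <= 1 by rewrite ltW.
have := convex_chord y v Fconv t01.
have := convex_chord (y + t *: v) (- v) Gconv t01.
rewrite scalerN addrK.
move: (Fr y (xr1 y xyr)) (Gr _ (xr2 _ xzr)) => /=.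
rewrite !ltr_norml; set z := y + t *: v.
set A := F (y + v) - F y; set B := G (z - v) - G z.
move=> /andP[Ae _] /andP[Be _] Bt At.
have ec : e * (c + 1) = - b / 2 by rewrite /e divfK// gt_eqF.
have AB : A + c * B < 0.
  have := ler_wpM2l c_ge0 (ltW Be); move: b0 ec Ae; rewrite /b /slope_bound.
  by rewrite -/z; lra.
have := ler_wpM2l c_ge0 Bt; have : t * (A + c * B) < 0 by rewrite pmulr_rlt0.
by rewrite /H; lra.
Qed.

(** The alternative in the third clause, immobile or strictly lower, is what
    makes composition work: a point moved by the first map is already lower,
    and a point not moved still lies where the second map is strict. *)
Definition descends (eta : 'rV[R]_n -> 'rV[R]_n) (W : set 'rV[R]_n) : Prop :=
  [/\ continuous eta, forall y, eta (- y) = - eta y,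
      forall y, eta y = y \/ H (eta y) < H y & forall y, W y -> H (eta y) < H y].

Lemma descends_comp eta1 eta2 W1 W2 : descends eta1 W1 -> descends eta2 W2 ->
  descends (eta2 \o eta1) (W1 `|` W2).
Proof.
move=> [c1 N1 m1 s1] [c2 N2 m2 s2].
have le2 y : H (eta2 y) <= H y by have [->|/ltW] := m2 y.
split=> [y|y|y|y].
- exact: continuous_comp (c1 y) (c2 _).
- by rewrite /= N1 N2.
- have [e1|lt1] := m1 y; last by right; exact: le_lt_trans (le2 _) lt1.
  by rewrite /= e1; exact: m2.
- move=> Wy; have [e1|lt1] := m1 y; last exact: le_lt_trans (le2 _) lt1.
  case: Wy => [/s1|/s2]; first by rewrite e1 ltxx.
  by rewrite /= e1.
Qed.

Lemma levelN y : H (- y) = H y.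
Proof. by rewrite /H FN GN. Qed.

(** The move is [y + step y v] with [step] the odd part of a bump function
    supported in a ball around [x]; the ball is disjoint from its antipode. *)
Lemma descends_nbhs x : x != 0 -> ~ critical x ->
  exists2 U, nbhs x U & exists eta, descends eta U.
Proof.
move=> x0 /existsNP[v /negP]; rewrite -ltNge => vb.
have [rho0 [rho00 [tau [tau0 desc]]]] := local_descent vb.
pose rho := Num.min rho0 `|x|.
have rho_gt0 : 0 < rho by rewrite lt_min rho00 normr_gt0.
have rho_le : rho <= `|x| by rewrite ge_min lexx orbT.
exists (ball x rho); first exact: nbhsx_ballx.
pose bump (y : 'rV[R]_n) : R := Num.max 0 (rho - `|y - x|).
pose step (y : 'rV[R]_n) : R := tau / rho * (bump y - bump (- y)).
have bump_in y : ball x rho y -> 0 < bump y <= rho.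
  rewrite -ball_normE /= distrC => yx; rewrite lt_max subr_gt0 yx orbT /=.
  by rewrite ge_max ltW//= gerBl.
have bump_out y : ~ ball x rho y -> bump y = 0.
  by rewrite -ball_normE /= distrC => /negP; rewrite -leNgt => yx; apply/max_idPl; lra.
have ball_sep y : ball x rho y -> ~ ball x rho (- y).
  rewrite -ball_normE /= => yx yx'.
  have : `|(x - y) + (x - - y)| < rho + rho.
    by apply: le_lt_trans (ler_normD _ _) _; rewrite ltrD.
  rewrite opprK addrACA addNr addr0 -mulr2n -scaler_nat normrZ normr_nat.
  by lra.
have descent_in y : ball x rho y -> H (y + step y *: v) < H y.
  move=> yx; have /andP[b0 b1] := bump_in y yx.
  apply: desc; first by apply: le_ball yx; rewrite ge_min lexx.
  rewrite /step (bump_out _ (ball_sep _ yx)) subr0 mulr_gt0 ?divr_gt0//=.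
  by rewrite -mulrA ger_pMr// mulrC ler_pdivrMr// mul1r.
have stepN y : step (- y) = - step y by rewrite /step opprK -mulrN opprB.
have etaN y : - y + step (- y) *: v = - (y + step y *: v).
  by rewrite stepN scaleNr opprD.
exists (fun y => y + step y *: v); split=> [y|y|y|//].
- apply: (@continuousD _ _ _ id (fun y => step y *: v)); first exact: cvg_id.
  apply: (@continuousZ _ _ _ step (fun=> v)); last exact: cst_continuous.
  have bump_cont : continuous bump.
    move=> z; apply: (@continuous_max R 'rV[R]_n (fun=> 0) (fun y : 'rV[R]_n => rho - `|y - x|)).
      exact: cst_continuous.
    apply: (@continuousB R R^o); first exact: cst_continuous.
    apply: (@cvg_norm _ _ _ (nbhs z) (nbhs_filter z) (fun y => y - x)).
    by apply: (@cvgB R 'rV[R]_n); [exact: cvg_id | exact: cvg_cst].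
  have bumpN_cont : {for y, continuous (fun y : 'rV[R]_n => bump (- y))}.
    apply: (@continuous_comp 'rV[R]_n 'rV[R]_n R (fun y => - y) bump); last exact: bump_cont.
    exact: oppr_continuous.
  apply: continuousM; first exact: cst_continuous.
  by apply: (@continuousB R R^o); first exact: bump_cont.
- exact: etaN.
- have [yx|yx] := pselect (ball x rho y); first by right; exact: descent_in.
  have [yx'|yx'] := pselect (ball x rho (- y)).
    by right; rewrite -levelN -etaN -(levelN y); exact: descent_in.
  by left; rewrite /step !bump_out// subrr mulr0 scale0r addr0.
Qed.

Lemma descends_compact (W : set 'rV[R]_n) : compact W -> (forall x, W x -> x != 0) ->
  (forall x, W x -> ~ critical x) -> exists eta, descends eta W.
Proof.
move=> cW W0 Wcrit.
have [|||V [eta [ec eN em es]] WV] :=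
  @compact_induction _ W (fun U => exists eta, descends eta U) cW.
- by exists id; split=> // [y|y]; [exact: cvg_id | left].
- by move=> A B [eta1 d1] [eta2 d2]; exists (eta2 \o eta1); exact: descends_comp.
- by move=> x Wx; apply: descends_nbhs; [exact: W0 | exact: Wcrit].
by exists eta; split=> // y /WV; exact: es.
Qed.

End Descent.

Section CompactBounds.
Variables (R : realType) (T : topologicalType).
Implicit Types (K : set T) (f : T -> R).

Lemma compact_upper_bound K f : compact K -> {within K, continuous f} ->
  exists2 M, 0 < M & forall x, K x -> f x <= M.
Proof.
move=> cK fc; have [K0|/set0P/negP/negPn/eqP->] := pselect (K !=set0); last first.
  by exists 1.
have [m _ fm] := compact_EVT_max K0 cK fc.
exists (Num.max 1 (f m)) => [|x Kx]; first by rewrite lt_max ltr01.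
by rewrite le_max fm ?orbT// inE.
Qed.

Lemma compact_strict_bound K f a : compact K -> {within K, continuous f} ->
  (forall x, K x -> f x < a) -> exists2 b, b < a & forall x, K x -> f x <= b.
Proof.
move=> cK fc fa; have [K0|/set0P/negP/negPn/eqP->] := pselect (K !=set0); last first.
  by exists (a - 1) => //; rewrite ltrBlDr ltrDl.
have [m Km fm] := compact_EVT_max K0 cK fc.
exists (f m) => [|x Kx]; first by apply: fa; rewrite inE in Km.
by apply: fm; rewrite inE.
Qed.

End CompactBounds.

Section MultiplicityTheorem.
Variables (R : realType) (n : nat) (F G : 'rV[R]_n -> R) (c p : R).
Hypotheses (Fconv : convex_fun F) (Gconv : convex_fun G).
Hypotheses (Fcont : continuous F) (Gcont : continuous G).
Hypotheses (FN : forall x : 'rV[R]_n, F (- x) = F x).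
Hypotheses (GN : forall x : 'rV[R]_n, G (- x) = G x).
Hypotheses (Fhom : forall (t : R) x, 0 < t -> F (t *: x) = t `^ p * F x).
Hypotheses (Ghom : forall (t : R) x, 0 < t -> G (t *: x) = t `^ p * G x).
Hypothesis c_ge0 : 0 <= c.

Let H (y : 'rV[R]_n) : R := F y - c * G y.

Let sphere : set 'rV[R]_n := [set x | `|x| = 1].

Lemma sphere_compact : compact sphere.
Proof.
rewrite (_ : sphere = [set y | 1 <= `|y| <= 1]); first exact: shell_compact.
apply/seteqP; split => y /=; first by move->; rewrite lexx.
by move=> y1; apply/eqP; rewrite eq_le andbC.
Qed.

Lemma critical_closed : closed [set x | critical F G c x].
Proof.
rewrite (_ : [set x | _] = \bigcap_(v in [set: 'rV[R]_n])
    (slope_bound F G c ^~ v @^-1` [set t | 0 <= t])); last first.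
  by apply/seteqP; split=> x /= cx v; [move=> _; exact: cx | exact: cx].
apply: closed_bigI => v _; apply: preimage_closed => [x _|]; last exact: closed_ge.
apply: (@continuousD R R^o _ (fun x : 'rV[R]_n => F (x + v) - F x)
  (fun x : 'rV[R]_n => c * (G (x - v) - G x))); first exact: (shift_continuous Fcont).
apply: continuousM; first exact: cst_continuous.
exact: (shift_continuous Gcont).
Qed.

Lemma criticalN x : critical F G c x -> critical F G c (- x).
Proof.
move=> cx v; have := cx (- v); rewrite /slope_bound opprK !FN !GN.
by rewrite -(FN (- x + v)) -(GN (- x - v)) !opprD !opprK.
Qed.

Definition direction (x : 'rV[R]_n) : 'rV[R]_n := `|x|^-1 *: x.

Lemma direction_sphere x : x != 0 -> sphere (direction x).
Proof.
move=> x0; rewrite /sphere /= normrZ ger0_norm ?invr_ge0//.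
by rewrite mulVf// normr_eq0.
Qed.

Lemma directionN x : direction (- x) = - direction x.
Proof. by rewrite /direction normrN scalerN. Qed.

Lemma direction_continuous x : x != 0 -> {for x, continuous direction}.
Proof.
move=> x0; apply: (@continuousZ _ _ _ (fun x : 'rV[R]_n => `|x|^-1) id).
  apply: continuousV; last exact: norm_continuous.
  by rewrite normr_eq0.
exact: cvg_id.
Qed.

(** By homogeneity both sides scale by the same positive factor. *)
Lemma level_direction x e : x != 0 -> H x <= e * G x ->
  H (direction x) <= e * G (direction x).
Proof.
move=> x0 Hx; have nx : 0 < `|x|^-1 by rewrite invr_gt0 normr_gt0.
rewrite /H /direction Fhom// Ghom// -subr_ge0.
rewrite (_ : _ - _ = `|x|^-1 `^ p * (e * G x - H x)).
  by rewrite mulr_ge0 ?powR_ge0// subr_ge0.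
by rewrite /H; ring.
Qed.

(** Project everything to the sphere, extend the odd map from the critical set
    to [h], and let [W] be the zeros of [h] on the sphere. On [W] there is an
    odd deformation [eta] which lowers [F - c G] by a definite amount, so it
    carries [W] intersected with a set slightly above level [c] strictly below
    that level, where an odd map [g] exists by assumption. The pair of [h] and
    [g] after [eta], with [g] extended, has no common zero. *)
Theorem sublevel_odd_map j s :
  (forall B : set 'rV[R]_n, compact B -> symmetric_set B ->
     (forall y, B y -> H y < 0) -> exists2 s', (s' < j)%N & odd_sphere_map B s') ->
  odd_sphere_map (sphere `&` [set x | critical F G c x]) s ->
  exists2 e, 0 < e &
    forall A : set 'rV[R]_n, compact A -> symmetric_set A -> A `<=` [set~ 0] ->
      (forall y, A y -> H y <= e * G y) ->
      exists2 s', (s' < j + s)%N & odd_sphere_map A s'.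
Proof.
move=> below critical_map.
have [||h [hc hN h1]] := odd_extension _ _ critical_map.
- apply: closedI critical_closed.
  exact: compact_closed (@norm_hausdorff _ _) sphere_compact.
- move=> x [x1 xcrit]; split; first by rewrite /sphere /= normrN.
  exact: criticalN.
pose W := sphere `&` [set x | h x = 0].
have Wcompact : compact W.
  apply: compact_closedI; first exact: sphere_compact.
  apply: (@preimage_closed _ _ h [set 0]) => [x _|]; first exact: hc.
  exact/accessible_closed_set1/hausdorff_accessible/norm_hausdorff.
have W0 x : W x -> x != 0.
  by move=> [x1 _]; rewrite -normr_gt0 x1 ltr01.
have Wcrit x : W x -> ~ critical F G c x.
  move=> [x1 hx0] xc.
  have /h1/unit_sphere_neq0 : (sphere `&` [set x | critical F G c x]) x by [].
  by rewrite hx0 eqxx.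
have [eta [etac etaN _ eta_lt]] :=
  descends_compact Fconv Gconv Fcont Gcont FN GN c_ge0 Wcompact W0 Wcrit.
have Hc : continuous H by exact: level_continuous.
have [||d d0 dW] := compact_strict_bound (f := fun y => H (eta y) - H y) (a := 0) Wcompact.
- apply: continuous_subspaceT => y.
  apply: (@continuousB R R^o _ (H \o eta) H); last exact: Hc.
  by apply: continuous_comp; [exact: etac | exact: Hc].
- by move=> y Wy; rewrite subr_lt0; exact: eta_lt.
have [M M0 GM] := compact_upper_bound sphere_compact (continuous_subspaceT Gcont).
(* With this choice, points of the sphere with [H <= e G] have [H <= - d / 2],
   less than the drop [- d] which [eta] achieves on [W]. *)
exists (- d / 2 / M); first by rewrite !divr_gt0// oppr_gt0.
set e := _ / M => A Acompact Asym A0 AH.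
pose B := eta @` (W `&` (direction @` A)).
have dirA : compact (direction @` A).
  apply: continuous_compact => //; apply: continuous_in_subspaceT => x /[!inE] Ax.
  by apply: direction_continuous; apply/eqP; exact: A0.
have Bcompact : compact B.
  apply: continuous_compact; first exact: continuous_subspaceT.
  apply: compact_closedI => //.
  exact: compact_closed (@norm_hausdorff _ _) dirA.
have Bsym : symmetric_set B.
  move=> _ [y [[y1 hy] [x Ax xy]] <-]; exists (- y); last by rewrite etaN.
  split; first by split; rewrite /sphere /= ?normrN// hN hy oppr0.
  by exists (- x); [exact: Asym | rewrite directionN xy].
have Bneg y : B y -> H y < 0.
  move=> [z [Wz [x Ax xz]] <-]; have := dW z Wz.
  have x0 : x != 0 by apply/eqP; exact: A0.
  have := level_direction x0 (AH x Ax); rewrite xz.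
  have := GM z Wz.1; have : e * M = - d / 2 by rewrite /e divfK// gt_eqF.
  have : 0 < e by rewrite !divr_gt0// oppr_gt0.
  by nra.
have [s' s'j Bmap] := below B Bcompact Bsym Bneg.
have [||g [gc gN g1]] := odd_extension _ _ Bmap => //.
  exact: compact_closed (@norm_hausdorff _ _) Bcompact.
exists (s + s')%N; first by rewrite addnC ltn_add2r.
pose k x := row_mx (h (direction x)) (g (eta (direction x))).
apply: (@odd_sphere_mapI _ _ _ _ k) => x Ax.
- have x0 : x != 0 by apply/eqP; exact: A0.
  have dc := direction_continuous x0.
  apply: (@cvg_row _ _ (nbhs x) (nbhs_filter x)) => i; rewrite /k mxE.
  under eq_fun do rewrite mxE.
  case: (fintype.split i) => i'.
    apply: (@continuous_coord _ _ _ (h \o direction)).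
    by apply: continuous_comp dc _; exact: hc.
  apply: (@continuous_coord _ _ _ (g \o (eta \o direction))).
  apply: continuous_comp; last exact: gc.
  by apply: continuous_comp dc _; exact: etac.
- by rewrite /k directionN hN etaN gN opp_row_mx.
- apply/eqP; rewrite /k -[0]row_mx0 => /eq_row_mx[hx0 gx0].
  have x0 : x != 0 by apply/eqP; exact: A0.
  have : B (eta (direction x)).
    exists (direction x) => //; split; last by exists x.
    by split=> //; exact: direction_sphere.
  by move=> /g1/unit_sphere_neq0; rewrite gx0 eqxx.
Qed.

End MultiplicityTheorem.

(** * Convexity and homogeneity of the graph energies *)

Section AbsPower.
Variables (R : realType) (p : R).
Hypothesis p_ge1 : 1 <= p.

Let p_gt0 : 0 < p. Proof. exact: lt_le_trans p_ge1. Qed.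

Definition abs_pow (t : R) : R := `|t| `^ p.

Lemma abs_pow_ge0 t : 0 <= abs_pow t. Proof. exact: powR_ge0. Qed.

Lemma abs_pow0 : abs_pow 0 = 0.
Proof. by rewrite /abs_pow normr0 powR0// gt_eqF. Qed.

Lemma abs_powN t : abs_pow (- t) = abs_pow t.
Proof. by rewrite /abs_pow normrN. Qed.

Lemma abs_powM s t : abs_pow (s * t) = abs_pow s * abs_pow t.
Proof. by rewrite /abs_pow normrM powRM. Qed.

Lemma abs_pow_gt0 t : t != 0 -> 0 < abs_pow t.
Proof. by move=> t0; rewrite powR_gt0// normr_gt0. Qed.

Lemma abs_pow_convex : convex_fun (abs_pow : R^o -> R).
Proof.
move=> t x y t01; have /andP[t0 t1] := t01.
have := @convex_powR R p p_ge1 (Itv01 t0 t1) `|x| `|y|.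
rewrite !inE /= !in_itv /= !normr_ge0 => /(_ isT isT).
rewrite !convRE /= => le; apply: le_trans le.
rewrite ge0_ler_powR ?nnegrE//; first exact: ltW.
  by rewrite addr_ge0// mulr_ge0// subr_ge0.
apply: le_trans (ler_normD _ _) _.
by rewrite !normrZ (ger0_norm t0) ger0_norm// subr_ge0.
Qed.

(** Away from zero by differentiability, and at zero by comparison with the
    absolute value. *)
Lemma abs_pow_continuous : continuous abs_pow.
Proof.
move=> x; have [->|x0] := eqVneq x 0; last first.
  apply: (@continuous_comp R R R (fun t => `|t|) (fun t => t `^ p)).
    exact: norm_continuous.
  have : derivable ((@powR R) ^~ p) `|x| 1.
    by apply: derivable_powR; rewrite in_itv /= normr_gt0 x0.
  by move=> /derivable1_diffP/differentiable_continuous.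
apply/cvgrPdist_lt => e e0; rewrite abs_pow0.
apply/nbhs_ballP; exists (Num.min 1 e) => /=; first by rewrite lt_min ltr01.
move=> t; rewrite /ball /= sub0r normrN lt_min => /andP[t1 te].
rewrite sub0r normrN ger0_norm ?abs_pow_ge0//; apply: le_lt_trans te.
have [->|t0] := eqVneq t 0; first by rewrite abs_pow0 normr0.
by rewrite ge1r_powR// normr_gt0 t0 ltW.
Qed.

End AbsPower.

Section ConvexSums.
Variables (R : realType) (V : lmodType R).

Lemma convex_fun_sum (I : Type) (r : seq I) (P : pred I) (f : I -> V -> R) :
  (forall i, P i -> convex_fun (f i)) ->
  convex_fun (fun x => \sum_(i <- r | P i) f i x).
Proof.
move=> fc t x y t01; rewrite !mulr_sumr -big_split /=.
by apply: ler_sum => i /fc; exact.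
Qed.

Lemma convex_funZ (a : R) (f : V -> R) : 0 <= a -> convex_fun f ->
  convex_fun (fun x => a * f x).
Proof.
move=> a0 fc t x y t01; have := ler_wpM2l a0 (fc t x y t01); lra.
Qed.

End ConvexSums.

Section Functionals.
Variables (R : realType) (n : nat) (e : rel 'I_n) (w : 'I_n -> 'I_n -> R) (p : R).
Hypothesis w_gt0 : forall i j : 'I_n, e i j -> 0 < w i j.
Hypothesis p_ge1 : 1 <= p.
Implicit Types (x y : 'rV[R]_n).

Let F := plap_num e w p.
Let G := plap_den e w p.

Let numE x : F x = \sum_(i < n) \sum_(j < n | (i < j)%N && e i j)
  w i j * abs_pow p (x 0 i - x 0 j).
Proof. by []. Qed.

Let denE x : G x = \sum_(i < n) wdeg e w i * abs_pow p (x 0 i).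
Proof. by []. Qed.

Lemma wdeg_ge0 i : 0 <= wdeg e w i.
Proof. by apply: sumr_ge0 => j /w_gt0/ltW. Qed.

Lemma plap_num_ge0 x : 0 <= F x.
Proof.
apply: sumr_ge0 => i _; apply: sumr_ge0 => j /andP[_ /w_gt0 wij].
by rewrite mulr_ge0 ?abs_pow_ge0// ltW.
Qed.

Lemma plap_num_convex : convex_fun F.
Proof.
apply: convex_fun_sum => i _; apply: convex_fun_sum => j /andP[_ /w_gt0 wij].
apply: convex_funZ; first exact: ltW.
move=> t x y t01; rewrite !mxE.
rewrite (_ : _ - _ = t * (x 0 i - x 0 j) + (1 - t) * (y 0 i - y 0 j)); last by ring.
exact: (abs_pow_convex p_ge1).
Qed.

Lemma plap_den_convex : convex_fun G.
Proof.
apply: convex_fun_sum => i _; apply: convex_funZ; first exact: wdeg_ge0.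
move=> t x y t01; rewrite !mxE; exact: (abs_pow_convex p_ge1).
Qed.

Lemma plap_num_continuous : continuous F.
Proof.
rewrite (_ : F = fun x => \sum_(i < n) \sum_(j < n | (i < j)%N && e i j)
  w i j * abs_pow p (x 0 i - x 0 j))// => x; apply: continuous_sum => i _.
apply: continuous_sum => j _.
apply: continuousM; first exact: cst_continuous.
apply: (@continuous_comp _ _ _ (fun x : 'rV[R]_n => x 0 i - x 0 j)); last first.
  exact: abs_pow_continuous.
by apply: (@continuousB R R^o); exact: coord_continuous.
Qed.

Lemma plap_den_continuous : continuous G.
Proof.
rewrite (_ : G = fun x => \sum_(i < n) wdeg e w i * abs_pow p (x 0 i))// => x.
apply: continuous_sum => i _.
apply: continuousM; first exact: cst_continuous.
apply: (@continuous_comp _ _ _ (fun x : 'rV[R]_n => x 0 i)); last exact: abs_pow_continuous.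
exact: coord_continuous.
Qed.

Lemma plap_numZ t x : F (t *: x) = abs_pow p t * F x.
Proof.
rewrite !numE mulr_sumr; apply: eq_bigr => i _.
rewrite mulr_sumr; apply: eq_bigr => j _.
by rewrite !mxE -mulrBr abs_powM mulrCA.
Qed.

Lemma plap_denZ t x : G (t *: x) = abs_pow p t * G x.
Proof.
rewrite !denE mulr_sumr; apply: eq_bigr => i _.
by rewrite !mxE abs_powM mulrCA.
Qed.

Lemma plap_numN x : F (- x) = F x.
Proof. by rewrite -scaleN1r plap_numZ abs_powN /abs_pow normr1 powR1 mul1r. Qed.

Lemma plap_denN x : G (- x) = G x.
Proof. by rewrite -scaleN1r plap_denZ abs_powN /abs_pow normr1 powR1 mul1r. Qed.

Lemma plap_num0 : F 0 = 0.
Proof. by rewrite -(scale0r 0) plap_numZ abs_pow0// mul0r. Qed.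

Lemma plap_den0 : G 0 = 0.
Proof. by rewrite -(scale0r 0) plap_denZ abs_pow0// mul0r. Qed.

Hypothesis no_isolated : forall i : 'I_n, exists j : 'I_n, e i j.

Lemma wdeg_gt0 i : 0 < wdeg e w i.
Proof.
have [j eij] := no_isolated i; rewrite /wdeg (bigD1 j)//=.
by rewrite ltr_pwDl ?w_gt0//; apply: sumr_ge0 => k /andP[/w_gt0/ltW].
Qed.

Lemma plap_den_gt0 x : x != 0 -> 0 < G x.
Proof.
move=> x0; have /existsP[i xi] : [exists i, x 0 i != 0].
  apply: contra_neqT x0 => /existsPn x0; apply/rowP => i; rewrite mxE.
  by apply/eqP; have := x0 i; rewrite negbK.
rewrite denE (bigD1 i)//= ltr_pwDl ?mulr_gt0 ?wdeg_gt0 ?abs_pow_gt0//.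
by apply: sumr_ge0 => j _; rewrite mulr_ge0 ?wdeg_ge0 ?abs_pow_ge0.
Qed.

End Functionals.

(** * The span of a family of blocks *)

Section Blocks.
Variables (R : realType) (n : nat) (x : 'rV[R]_n) (l : 'I_n -> 'I_n).
Hypothesis l_supp : forall u, u \in supp x -> l u \in supp x.
Hypothesis l_idem : forall u, u \in supp x -> l (l u) = l u.

(** The label [l u] of a vertex of the support is a chosen vertex of its
    block, and blocks are counted by their chosen vertices. *)
Definition block_reps : {set 'I_n} := [set u in supp x | l u == u]%SET.

Definition scale_blocks (t : 'rV[R]_n) : 'rV[R]_n := \row_u (t 0 (l u) * x 0 u).

Lemma suppP u : reflect (x 0 u = 0) (u \notin supp x).
Proof. by rewrite inE negbK; exact: eqP. Qed.

Lemma block_reps_l u : u \in supp x -> l u \in block_reps.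
Proof. by move=> us; rewrite inE l_supp// l_idem//= eqxx. Qed.

Section SpanSphere.
Let k := #|block_reps|.

Definition block_coords (s : 'rV[R]_k) : 'rV[R]_n :=
  \row_u \sum_(j < k) (if enum_val j == u then s 0 j else 0).

Definition block_span (s : 'rV[R]_k) := scale_blocks (block_coords s).

Lemma block_span_val (s : 'rV[R]_k) j :
  block_span s 0 (enum_val j) = s 0 j * x 0 (enum_val j).
Proof.
have := enum_valP j; rewrite inE => /andP[_ /eqP lj].
rewrite !mxE lj (bigD1 j)//= eqxx big1 ?addr0// => i ij.
by rewrite (inj_eq enum_val_inj) (negPf ij).
Qed.

Lemma block_spanN s : block_span (- s) = - block_span s.
Proof.
apply/rowP => u; rewrite !mxE -mulNr -sumrN; congr (_ * _).
by apply: eq_bigr => j _; rewrite mxE; case: eqP; rewrite ?oppr0.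
Qed.

Lemma block_span_neq0 s : s != 0 -> block_span s != 0.
Proof.
move=> s0; apply: contra_neq s0 => ys; apply/rowP => j; rewrite mxE.
have /eqP := block_span_val s j; rewrite ys mxE eq_sym mulf_eq0.
have := enum_valP j; rewrite !inE => /andP[/negPf -> _].
by rewrite orbF => /eqP.
Qed.

Lemma block_span_continuous : continuous block_span.
Proof.
move=> s; apply: (@cvg_row _ _ (nbhs s) (nbhs_filter s)) => u.
rewrite mxE; under eq_fun do rewrite mxE.
apply: cvgM; last exact: cvg_cst.
rewrite mxE; under eq_fun do rewrite mxE.
apply: continuous_sum => j _; case: eqP => _; last exact: cst_continuous.
exact: coord_continuous.
Qed.

Definition block_sphere : set 'rV[R]_n := block_span @` [set s | `|s| = 1].

Lemma block_sphere_compact : compact block_sphere.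
Proof.
apply: continuous_compact; last exact: sphere_compact.
exact: continuous_subspaceT block_span_continuous.
Qed.

Lemma block_sphere_sym : symmetric_set block_sphere.
Proof.
by move=> _ [s s1 <-]; exists (- s); rewrite ?block_spanN//= normrN.
Qed.

Lemma block_sphere_neq0 : block_sphere `<=` [set~ 0].
Proof.
move=> _ [s s1 <-] /eqP; apply/negP; apply: block_span_neq0.
by rewrite -normr_gt0 s1.
Qed.

(** An odd map on the image of the sphere yields an odd map on the sphere of
    dimension [k - 1], to which the Borsuk-Ulam theorem applies. *)
Lemma block_sphere_genus s : odd_sphere_map block_sphere s -> (k <= s)%N.
Proof.
move=> /odd_extension[||f [fc fN f1]].
- exact: compact_closed (@norm_hausdorff _ _) block_sphere_compact.
- exact: block_sphere_sym.
apply: (@borsuk_ulam R k s (fun y => f (block_span (direction y)))) => y y0.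
- apply: (@continuous_comp 'rV[R]_k 'rV[R]_k 'rV[R]_s (@direction R k) (f \o block_span)).
    exact: direction_continuous.
  by apply: continuous_comp; [exact: block_span_continuous | exact: fc].
- by rewrite directionN block_spanN fN.
- by apply: f1; exists (direction y) => //; exact: direction_sphere.
Qed.

End SpanSphere.

(** Linear forms indexed by the vertices which are not representatives, with
    common kernel the span of the blocks; at a representative the form is
    zero. *)
Definition off_span (y : 'rV[R]_n) u : R :=
  y 0 u - (if u \in supp x then x 0 u / x 0 (l u) * y 0 (l u) else 0).

Lemma off_span_eq0 y : (forall u, u \notin block_reps -> off_span y u = 0) ->
  exists t, y = scale_blocks t.
Proof.
move=> yr; exists (\row_u (y 0 u / x 0 u)); apply/rowP => u; rewrite !mxE.
have [us|us] := boolP (u \in supp x); last first.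
  have ur : u \notin block_reps by rewrite inE negb_and us.
  have := yr u ur; rewrite /off_span (negPf us) subr0 => ->.
  by rewrite (suppP u us) mulr0.
have xlu : x 0 (l u) != 0 by have := l_supp us; rewrite inE.
have [ur|ur] := boolP (u \in block_reps).
  move: ur; rewrite inE => /andP[_ /eqP lu]; rewrite lu divfK//.
  by rewrite -lu.
have := yr u ur; rewrite /off_span us => /eqP; rewrite subr_eq0 => /eqP ->.
by field.
Qed.

Lemma odd_map_off_span (B : set 'rV[R]_n) :
  (forall t, ~ B (scale_blocks t)) -> odd_sphere_map B (n - #|block_reps|).
Proof.
move=> Bt; have <- : #|~: block_reps|%SET = (n - #|block_reps|)%N.
  by rewrite cardsCs finset.setCK card_ord.
pose off (y : 'rV[R]_n) : 'rV[R]_#|~: block_reps|%SET :=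
  \row_j off_span y (enum_val j).
apply: (@odd_sphere_mapI _ _ _ _ off) => y By.
- apply: (@cvg_row _ _ (nbhs y) (nbhs_filter y)) => j.
  rewrite mxE; under eq_fun do rewrite mxE.
  apply: (@cvgB R R^o); first exact: coord_continuous.
  case: ifP => _; last exact: cvg_cst.
  by apply: cvgM; [exact: cvg_cst | exact: coord_continuous].
- apply/rowP => j; rewrite !mxE /off_span !mxE; case: ifP => _; last by ring.
  by ring.
- apply/eqP => /rowP off0; have [|t yt] := @off_span_eq0 y.
    move=> u ur; have uC : u \in (~: block_reps)%SET by rewrite inE.
    by have := off0 (enum_rank_in uC u); rewrite !mxE enum_rankK_in.
  by apply: (Bt t); rewrite -yt.
Qed.

End Blocks.

(** * Energies of blocks and eigenvectors *)

Section PowerSlope.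
Variables (R : realType) (p : R).
Hypothesis p_ge1 : 1 <= p.

Let incr (s : R) := (1 + s) `^ p - 1.

Let pow1 : 1 `^ p = 1 :> R. Proof. by rewrite powR1. Qed.

(** Two slopes supporting [(1 + s)^p - 1] at zero satisfy
    [(1 + k s) (1 - k' s) <= (1 - s^2)^p <= 1] for small [s > 0], and hence
    [k <= k']. This replaces differentiation of the power. *)
Lemma power_slope_le (k k' : R) :
  (forall s, `|s| < 1 -> k * s <= incr s) ->
  (forall s, `|s| < 1 -> k' * s <= incr s) -> k <= k'.
Proof.
move=> kp kp'; apply/ler_addgt0Pr => d d0.
have [k0 k'0 kk0] : [/\ 0 <= `|k|, 0 <= `|k'| & 0 <= `|k * k'| / d].
  by split=> //; rewrite divr_ge0// ltW.
have [M [M1 Mk Mk' Mkk]] :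
    exists M, [/\ 1 <= M, `|k| <= M, `|k'| <= M & `|k * k'| / d <= M].
  by exists (`|k| + `|k'| + `|k * k'| / d + 1); split; lra.
(* Any step small compared to the inverse of [M] will do. *)
have [s [s0 sM]] : exists s, 0 < s /\ s * M = 2^-1.
  exists (2^-1 / M); split; last by rewrite divfK//; lra.
  by rewrite divr_gt0//; lra.
have s1 : `|s| < 1 by rewrite gtr0_norm//; nra.
have sN1 : `|- s| < 1 by rewrite normrN.
have sk : `|k| * s < 1 by nra.
have sk' : `|k'| * s < 1 by nra.
have skk : `|k * k'| * s <= d.
  have : `|k * k'| / d * s <= 1 by nra.
  by rewrite mulrAC ler_pdivrMr// mul1r.
have prod_le : (1 + k * s) * (1 - k' * s) <= 1.
  have [ks k's] : 0 <= 1 + k * s /\ 0 <= 1 - k' * s.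
    by move: (ler_norm (- k)) (ler_norm k'); rewrite normrN; split; nra.
  apply: (@le_trans _ _ ((1 + s) `^ p * (1 - s) `^ p)).
    apply: ler_pM => //; first by have := kp s s1; rewrite /incr; lra.
    by have := kp' (- s) sN1; rewrite /incr; lra.
  move: s1; rewrite ltr_norml => /andP[sl su].
  rewrite -powRM; [|lra|lra].
  have q0 : 0 <= (1 + s) * (1 - s) by apply: mulr_ge0; lra.
  have q1 : (1 + s) * (1 - s) <= 1 by have := sqr_ge0 s; lra.
  have p0 : 0 <= p by exact: le_trans p_ge1.
  by rewrite -[leRHS]pow1; apply: ge0_ler_powR; rewrite ?nnegrE.
move: (ler_norm (k * k')) => kk.
have : (k - k') * s <= k * k' * s * s by nra.
rewrite ler_pM2r// => kk'; nra.
Qed.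

Lemma power_slope_prop (a b A B : R) : 0 <= A -> 0 < B ->
  (forall s, `|s| < 1 -> a * s <= incr s * A) ->
  (forall s, `|s| < 1 -> b * s <= incr s * B) -> a * B = b * A /\ 0 < b.
Proof.
move=> A0 B0 aA bB.
have half1 : `|2^-1| < 1 :> R by rewrite ger0_norm ?invr_ge0// invf_lt1 ?ltr1n.
split; last first.
  have h1 : `|- 2^-1| < 1 :> R by rewrite normrN.
  have := bB _ h1; suff : incr (- 2^-1) < 0 by nra.
  rewrite /incr subr_lt0 -[ltRHS]pow1; apply: gt0_ltr_powR; rewrite ?nnegrE; try lra.
  exact: lt_le_trans p_ge1.
have rescale c C : 0 < C -> (forall s, `|s| < 1 -> c * s <= incr s * C) ->
    forall s, `|s| < 1 -> c / C * s <= incr s.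
  by move=> C0 cC s s1; rewrite mulrAC ler_pdivrMr//; exact: cC.
move: A0; rewrite le_eqVlt => /predU1P[A0|A0].
  have halfN1 : `|- 2^-1| < 1 :> R by rewrite normrN.
  by have := aA _ half1; have := aA _ halfN1; rewrite -A0 !mulr0; nra.
have : a / A = b / B.
  apply/eqP; rewrite eq_le.
  by apply/andP; split; apply: power_slope_le; exact: rescale.
by move/eqP; rewrite eqr_div ?lt0r_neq0// => /eqP.
Qed.

(** Testing the inclusion of subgradients in the direction [z] gives, for [F]
    and for [G], a slope supporting the same function of [s] scaled by [F z]
    and by [G z] respectively. These slopes have ratio [lam], and by
    [power_slope_prop] they are proportional to [F z] and [G z]. *)
Lemma eigen_rayleigh n (F G : 'rV[R]_n -> R) (lam : R) (x z : 'rV[R]_n) :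
  convex_fun F -> convex_fun G -> continuous F -> continuous G ->
  eigenpair F G lam x ->
  (forall s, `|s| < 1 -> F (x + s *: z) - F x = incr s * F z) ->
  (forall s, `|s| < 1 -> G (x + s *: z) - G x = incr s * G z) ->
  0 <= F z -> 0 < G z -> F z = lam * G z.
Proof.
move=> Fconv Gconv Fcont Gcont [_ [xi [xiF [eta etaG lam_eta]]]] Fz Gz Fz0 Gz0.
move: xiF etaG; rewrite !clarke_subdiff_convex// => xiF etaG.
have [||ab b0] := @power_slope_prop (dotrv xi z) (dotrv eta z) (F z) (G z) Fz0 Gz0.
- by move=> s s1; rewrite -Fz// mulrC -dotrvZr; exact: xiF.
- by move=> s s1; rewrite -Gz// mulrC -dotrvZr; exact: etaG.
move: ab; rewrite -lam_eta dotrvZl => ab.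
by apply: (mulfI (lt0r_neq0 b0)); rewrite -ab; ring.
Qed.

End PowerSlope.

Section BlockEnergy.
Variables (R : realType) (n : nat) (e : rel 'I_n) (w : 'I_n -> 'I_n -> R) (p : R).
Variables (x : 'rV[R]_n) (l : 'I_n -> 'I_n).
Hypothesis w_gt0 : forall i j : 'I_n, e i j -> 0 < w i j.
Hypothesis p_ge1 : 1 <= p.
Hypothesis no_isolated : forall i : 'I_n, exists j : 'I_n, e i j.
Hypothesis l_supp : forall u, u \in supp x -> l u \in supp x.
Hypothesis l_idem : forall u, u \in supp x -> l (l u) = l u.
Hypothesis l_edge : forall u v, u \in supp x -> v \in supp x -> e u v -> l u = l v.

Let F := plap_num e w p.
Let G := plap_den e w p.
Let reps := block_reps x l.

Definition block r : 'rV[R]_n := \row_u (if l u == r then x 0 u else 0).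

(** An edge meets at most one block, so at most one term of the sum is
    nonzero. *)
Lemma abs_pow_blocks (t : 'rV[R]_n) u v :
  (u \in supp x -> v \in supp x -> l u = l v) ->
  abs_pow p (scale_blocks x l t 0 u - scale_blocks x l t 0 v) =
  \sum_(r in reps) abs_pow p (t 0 r) * abs_pow p (block r 0 u - block r 0 v).
Proof.
move=> luv.
have one_block r0 : r0 \in reps -> (u \in supp x -> l u = r0) ->
    (v \in supp x -> l v = r0) ->
  abs_pow p (scale_blocks x l t 0 u - scale_blocks x l t 0 v) =
  \sum_(r in reps) abs_pow p (t 0 r) * abs_pow p (block r 0 u - block r 0 v).
  move=> r0r lu lv; rewrite (bigD1 r0)//= big1 ?addr0.
    rewrite -abs_powM mulrBr !mxE; congr (abs_pow p (_ - _)).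
      have [/lu ->|/suppP ->] := boolP (u \in supp x); first by rewrite eqxx.
      by case: ifP; rewrite !mulr0.
    have [/lv ->|/suppP ->] := boolP (v \in supp x); first by rewrite eqxx.
    by case: ifP; rewrite !mulr0.
  move=> r /andP[_ /negPf rr0].
  have out a : (a \in supp x -> l a = r0) -> block r 0 a = 0.
    move=> la; rewrite mxE; have [/la ->|/suppP ->] := boolP (a \in supp x).
      by rewrite eq_sym rr0.
    by rewrite if_same.
  by rewrite !out// subr0 abs_pow0// mulr0.
have [us|us] := boolP (u \in supp x).
  by apply: (one_block (l u)) => // [|vs]; [exact: block_reps_l | rewrite luv].
have [vs|vs] := boolP (v \in supp x).
  by apply: (one_block (l v)) => //; [exact: block_reps_l | rewrite (negPf us)].
rewrite !mxE (suppP _ _ us) (suppP _ _ vs) !mulr0 subr0 abs_pow0// big1// => r _.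
by rewrite !mxE (suppP _ _ us) (suppP _ _ vs) !if_same subr0 abs_pow0// mulr0.
Qed.

Lemma plap_num_blocks t :
  F (scale_blocks x l t) = \sum_(r in reps) abs_pow p (t 0 r) * F (block r).
Proof.
transitivity (\sum_(i < n) \sum_(j < n | (i < j)%N && e i j) \sum_(r in reps)
    abs_pow p (t 0 r) * (w i j * abs_pow p (block r 0 i - block r 0 j))).
  apply: eq_bigr => i _; apply: eq_bigr => j /andP[_ eij].
  rewrite -[X in _ * X]/(abs_pow p _) abs_pow_blocks => [|us vs]; last exact: l_edge.
  by rewrite mulr_sumr; apply: eq_bigr => r _; rewrite mulrCA.
under eq_bigr => i _ do rewrite exchange_big /=.
rewrite exchange_big /=; apply: eq_bigr => r _.
by rewrite mulr_sumr; apply: eq_bigr => i _; rewrite mulr_sumr.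
Qed.

Lemma plap_den_blocks t :
  G (scale_blocks x l t) = \sum_(r in reps) abs_pow p (t 0 r) * G (block r).
Proof.
transitivity (\sum_(i < n) \sum_(r in reps)
    abs_pow p (t 0 r) * (wdeg e w i * abs_pow p (block r 0 i))).
  apply: eq_bigr => i _; rewrite -[X in _ * X]/(abs_pow p _).
  have [is_|is_] := boolP (i \in supp x); last first.
    rewrite mxE (suppP _ _ is_) mulr0 abs_pow0// mulr0 big1// => r _.
    by rewrite mxE (suppP _ _ is_) if_same abs_pow0// !mulr0.
  rewrite (bigD1 (l i)) ?block_reps_l//= big1 => [|r /andP[_ /negPf rl]]; last first.
    by rewrite mxE eq_sym rl abs_pow0// !mulr0.
  by rewrite addr0 !mxE eqxx abs_powM mulrCA.
rewrite exchange_big /=; apply: eq_bigr => r _.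
by rewrite mulr_sumr.
Qed.

Lemma scale_blocks1 : scale_blocks x l (const_mx 1) = x.
Proof. by apply/rowP => u; rewrite !mxE mul1r. Qed.

Lemma scale_blocks_add r s :
  scale_blocks x l (const_mx 1 + s *: delta_mx 0 r) = x + s *: block r.
Proof.
apply/rowP => u; rewrite !mxE eqxx /= mulrDl mul1r; congr (_ + _).
by case: eqP; rewrite ?mulr1 ?mulr0 ?mul0r.
Qed.

Lemma block_neq0 r : r \in reps -> block r != 0.
Proof.
rewrite inE => /andP[rs /eqP lr]; apply/eqP => /rowP/(_ r).
by rewrite !mxE lr eqxx => /eqP; apply/negP; move: rs; rewrite inE.
Qed.

(** Varying the scale of a single block changes [F] and [G] by [(1 + s)^p - 1]
    times the energies of that block, so [eigen_rayleigh] applies to it. *)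
Lemma eigen_blocks lam : plap_eigenpair e w p lam x ->
  forall t, F (scale_blocks x l t) = lam * G (scale_blocks x l t).
Proof.
move=> eig t; rewrite plap_num_blocks plap_den_blocks mulr_sumr.
apply: eq_bigr => r rr; rewrite mulrCA; congr (_ * _).
have incr (Q : 'rV[R]_n -> R) : (forall t, Q (scale_blocks x l t) =
    \sum_(r in reps) abs_pow p (t 0 r) * Q (block r)) ->
  forall s, `|s| < 1 -> Q (x + s *: block r) - Q x = ((1 + s) `^ p - 1) * Q (block r).
  move=> Qblocks s s1; rewrite -{2}scale_blocks1 -scale_blocks_add !Qblocks.
  rewrite (bigD1 r)//= [X in _ - X](bigD1 r)//=.
  have -> : \sum_(r' in reps | r' != r)
        abs_pow p ((const_mx 1 + s *: delta_mx 0 r : 'rV[R]_n) 0 r') * Q (block r') =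
      \sum_(r' in reps | r' != r) abs_pow p (const_mx 1 (0 : 'I_1) r') * Q (block r').
    apply: eq_bigr => r' /andP[_ /negPf r'r].
    by rewrite !mxE eqxx /= r'r mulr0 addr0.
  have s1' : 0 <= 1 + s by move: s1; rewrite ltr_norml; lra.
  rewrite opprD addrACA subrr addr0 -mulrBl !mxE !eqxx /= mulr1.
  by rewrite {2}/abs_pow normr1 powR1 /abs_pow ger0_norm.
apply: (eigen_rayleigh p_ge1 _ _ _ _ eig).
- exact: plap_num_convex.
- exact: plap_den_convex.
- exact: plap_num_continuous.
- exact: plap_den_continuous.
- exact: incr plap_num_blocks.
- exact: incr plap_den_blocks.
- exact: plap_num_ge0.
- by apply: plap_den_gt0 => //; exact: block_neq0.
Qed.

End BlockEnergy.

(** * Min-max values *)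

Section MinMax.
Variables (R : realType) (n : nat) (F G : 'rV[R]_n -> R).
Hypothesis G_gt0 : forall x, x != 0 -> 0 < G x.

Definition admissible (i : nat) (A : set 'rV[R]_n) : Prop :=
  [/\ compact A, symmetric_set A, A `<=` [set~ 0]
    & ((i%:R : R)%:E <= genus A)%E].

Lemma admissible_gt0 i A y : admissible i A -> A y -> 0 < G y.
Proof. by move=> [_ _ A0 _] Ay; apply: G_gt0; apply/eqP; exact: A0. Qed.

Lemma minmax_le i A c : admissible i A -> (forall y, A y -> F y <= c * G y) ->
  (minmax F G i <= c%:E)%E.
Proof.
move=> Aadm Ac; apply: ge_ereal_inf.
exists (ereal_sup [set (F x / G x)%:E | x in A]); first by exists A.
apply: ge_ereal_sup => _ [y Ay <-].
by rewrite lee_fin ler_pdivrMr ?(admissible_gt0 Aadm)//; exact: Ac.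
Qed.

Lemma minmax_ge i c :
  (forall A, admissible i A -> exists2 y, A y & c * G y <= F y) ->
  (c%:E <= minmax F G i)%E.
Proof.
move=> Ac; apply: le_ereal_inf_tmp => _ [A Aadm <-].
have [y Ay cy] := Ac A Aadm; apply: le_ereal_sup_tmp.
exists (F y / G y)%:E; first by exists y.
by rewrite lee_fin ler_pdivlMr// (admissible_gt0 Aadm).
Qed.

Lemma minmax_lt i c : (minmax F G i < c%:E)%E ->
  exists2 A, admissible i A & forall y, A y -> F y <= c * G y.
Proof.
move=> /ereal_inf_lt[_ [A Aadm <-] Ac]; exists A => // y Ay.
rewrite -ler_pdivrMr ?(admissible_gt0 Aadm)// -lee_fin ltW//.
by apply: le_lt_trans Ac; apply: ereal_sup_ubound; exists y.
Qed.

Hypotheses (Fcont : continuous F) (Gcont : continuous G).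
Hypotheses (F0 : F 0 = 0) (G0 : G 0 = 0).

(** On a compact set where [F - c G] is negative the quotient [F / G] stays
    below some [b < c], so that such a set of genus at least [i] would
    contradict the definition of the min-max value. *)
Lemma sublevel_genus_lt i c B : minmax F G i = c%:E -> compact B ->
  symmetric_set B -> (forall y, B y -> F y - c * G y < 0) ->
  exists2 s, (s < i)%N & odd_sphere_map B s.
Proof.
move=> Ei Bcomp Bsym Bneg; apply: genus_lt => iB.
have B0 : B `<=` [set~ 0].
  by move=> y By y0; have := Bneg y By; rewrite y0 F0 G0 mulr0 subr0 ltxx.
have Badm : admissible i B by [].
have [||b bc bB] := @compact_strict_bound R _ B (fun y => F y / G y) c Bcomp.
- apply: continuous_in_subspaceT => y /[!inE] By.
  apply: (@continuousM R _ F (fun y => (G y)^-1)); first exact: Fcont.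
  apply: continuousV; last exact: Gcont.
  by rewrite gt_eqF// (admissible_gt0 Badm).
- move=> y By; rewrite ltr_pdivrMr ?(admissible_gt0 Badm)//.
  by rewrite -subr_lt0; exact: Bneg.
suff : (minmax F G i <= b%:E)%E by rewrite Ei lee_fin leNgt bc.
apply: (minmax_le Badm) => y By.
by rewrite -ler_pdivrMr ?(admissible_gt0 Badm)//; exact: bB.
Qed.

End MinMax.

Section Components.
Variables (R : realType) (n : nat) (e : rel 'I_n).
Hypothesis e_sym : symmetric e.
Variable S : {set 'I_n}.

Let eS := induced_rel e S.

Lemma induced_connect_sym : connect_sym eS.
Proof.
apply: sym_connect_sym => u v; rewrite /eS /induced_rel /= e_sym.
by rewrite andbCA.
Qed.

Lemma root_in_set u : u \in S -> fingraph.root eS u \in S.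
Proof.
move=> uS; suff clS : closed_mem eS (mem S) by rewrite -(closed_connect clS (connect_root _ u)).
by move=> a b /= /and3P[-> ->].
Qed.

Lemma root_edge u v : u \in S -> v \in S -> e u v ->
  fingraph.root eS u = fingraph.root eS v.
Proof.
move=> uS vS euv; apply/eqP; rewrite root_connect; last exact: induced_connect_sym.
by apply: connect1; rewrite /eS /induced_rel /= uS vS.
Qed.

End Components.

Lemma num_components_reps (R : realType) n (e : rel 'I_n) (x : 'rV[R]_n) :
  num_components e (supp x) =
  #|block_reps x (fingraph.root (induced_rel e (supp x)))|.
Proof.
by apply: eq_card => u; rewrite !inE /= andbC.
Qed.

Section BlockBounds.
Variables (R : realType) (n : nat) (e : rel 'I_n) (w : 'I_n -> 'I_n -> R) (p : R).
Hypothesis w_gt0 : forall i j : 'I_n, e i j -> 0 < w i j.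
Hypothesis no_isolated : forall i : 'I_n, exists j : 'I_n, e i j.
Hypothesis p_ge1 : 1 <= p.
Variables (x : 'rV[R]_n) (l : 'I_n -> 'I_n) (c : R).
Hypothesis l_supp : forall u, u \in supp x -> l u \in supp x.

Let F := plap_num e w p.
Let G := plap_den e w p.
Let k := #|block_reps x l|.

Hypothesis flat : forall t, F (scale_blocks x l t) = c * G (scale_blocks x l t).

Let Ggt0 : forall y, y != 0 -> 0 < G y.
Proof. by move=> y; exact: plap_den_gt0. Qed.

Lemma block_sphere_admissible i : (i <= k)%N -> admissible i (block_sphere x l).
Proof.
move=> ik; split.
- exact: block_sphere_compact.
- exact: block_sphere_sym.
- exact: block_sphere_neq0.
- by apply/genus_ge => s /block_sphere_genus; exact: leq_trans.
Qed.

Lemma block_sphere_flat y : block_sphere x l y -> F y = c * G y.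
Proof. by move=> [s _ <-]; exact: flat. Qed.

Lemma flat_minmax_le i : (i <= k)%N -> (plap_minmax e w p i <= c%:E)%E.
Proof.
move=> ik; apply: (minmax_le Ggt0 (block_sphere_admissible ik)) => y.
by move=> /block_sphere_flat/eqP; rewrite eq_le => /andP[].
Qed.

Lemma flat_minmax_ge i : (n - k < i)%N -> (c%:E <= plap_minmax e w p i)%E.
Proof.
move=> ik; apply: (minmax_ge Ggt0) => A [_ _ _ /genus_ge Ai].
have [[t At]|noA] := pselect (exists t, A (scale_blocks x l t)).
  by exists (scale_blocks x l t) => //; rewrite -flat.
have := Ai (n - k)%N; rewrite leqNgt ik => /(_ _)/negP[]//.
by apply: odd_map_off_span => // t At; apply: noA; exists t.
Qed.

(** The sandwich theorem applied to the increments of [F] and of [c G]. The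
    level [c = 0] is special: the separating vector is then zero, and any
    subgradient of [G] will do. *)
Lemma critical_eigenpair y : 0 <= c -> y != 0 -> critical F G c y ->
  plap_eigenpair e w p c y.
Proof.
move=> c0 y0 crit; split=> //.
have Fconv := plap_num_convex w_gt0 p_ge1; have Gconv := plap_den_convex w_gt0 p_ge1.
have Fcont := @plap_num_continuous R n e w p p_ge1.
have Gcont := @plap_den_continuous R n e w p p_ge1.
rewrite !clarke_subdiff_convex//.
have [] := @convex_sandwich R n (fun v => F (y + v) - F y) (fun v => c * (G (y + v) - G y)).
- exact: convex_translate.
- by apply: convex_funZ => //; exact: convex_translate.
- by rewrite addr0 subrr.
- by rewrite addr0 subrr mulr0.
- exact: crit.
move=> xi xiP; exists xi; split; first by move=> v; have [] := xiP v.
move: c0; rewrite le_eqVlt => /predU1P[c0|c0]; last first.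
  exists (c^-1 *: xi); last by rewrite scalerA divff ?scale1r// gt_eqF.
  by move=> v; rewrite dotrvZl mulrC ler_pdivrMr// mulrC; have [] := xiP v.
have [||eta etaP] := @convex_subgradient R n (fun v => G (y + v) - G y).
- exact: convex_translate.
- by rewrite addr0 subrr.
exists eta => //; rewrite -c0 scale0r; apply/rowP => j; rewrite mxE.
have xi_le v : dotrv xi v <= 0 by have [_] := xiP v; rewrite -c0 mul0r.
have dot_delta a : dotrv xi (a *: delta_mx 0 j) = a * xi 0 j.
  rewrite dotrvZr; congr (_ * _); rewrite /dotrv (bigD1 j)//= big1 => [|i /negPf ij].
    by rewrite !mxE !eqxx mulr1 addr0.
  by rewrite !mxE ij andbF mulr0.
have := xi_le (1 *: delta_mx 0 j); have := xi_le (-1 *: delta_mx 0 j).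
by rewrite !dot_delta; lra.
Qed.

(** If [k] were larger than [i + r - 1], the sphere of the span would be a set
    at level [c] of genus at least [i + r], which [sublevel_odd_map] excludes
    with [j = i]. If [k] were larger than [n - i + r], take [j = n - k + 1]:
    sets below level [c] avoid the span, so they have genus less than [j], and
    sets slightly above level [c] have genus less than [j + r <= i], contrary
    to the value of the [i]-th min-max eigenvalue. *)
Lemma flat_count_le i r : 0 <= c -> (1 <= i <= n)%N ->
  plap_minmax e w p i = c%:E -> plap_multiplicity e w p c = (r%:R : R)%:E ->
  (k <= minn (i + r - 1) (n - i + r))%N.
Proof.
move=> c0 i_bounds Ei /genus_eq[s sr eig_map].
have critical_map : odd_sphere_map
    ([set y | `|y| = 1] `&` [set y | critical F G c y]) s.
  apply: odd_sphere_map_sub eig_map => y [y1 crit].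
  by apply: critical_eigenpair => //; rewrite -normr_gt0 y1.
have hom (Q : 'rV[R]_n -> R) : (forall t y, Q (t *: y) = abs_pow p t * Q y) ->
    forall t y, 0 < t -> Q (t *: y) = t `^ p * Q y.
  by move=> QZ t y t0; rewrite QZ /abs_pow gtr0_norm.
have sublevel j below := @sublevel_odd_map R n F G c p
  (plap_num_convex w_gt0 p_ge1) (plap_den_convex w_gt0 p_ge1)
  (@plap_num_continuous R n e w p p_ge1) (@plap_den_continuous R n e w p p_ge1)
  (plap_numN e w p) (plap_denN e w p) (hom _ (plap_numZ e w p))
  (hom _ (plap_denZ e w p)) c0 j s below critical_map.
have kn : (k <= n)%N by rewrite -[leqRHS]card_ord max_card.
have kmax : (k <= i + r - 1)%N.
  have [B Bc Bs Bneg|eps eps0 small] := sublevel i.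
    apply: (sublevel_genus_lt Ggt0 _ _ _ _ Ei Bc Bs Bneg).
    - exact: plap_num_continuous.
    - exact: plap_den_continuous.
    - exact: plap_num0.
    - exact: plap_den0.
  have [sph_c sph_s sph_0 _] := block_sphere_admissible (leqnn k).
  have [y yA|s' s'lt] := small _ sph_c sph_s sph_0.
    rewrite (block_sphere_flat yA) subrr mulr_ge0 ?ltW// Ggt0//.
    by apply/eqP; exact: sph_0.
  by move=> /block_sphere_genus ks'; rewrite -/k in ks' *; lia.
rewrite leq_min kmax /=.
have [B Bc Bs Bneg|eps eps0 small] := sublevel (n - k).+1.
  exists (n - k)%N => //; apply: odd_map_off_span => // t Bt.
  by have := Bneg _ Bt; rewrite flat subrr ltxx.
have [A [Ac As A0 /genus_ge Ai] Alt] : exists2 A, admissible i A &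
    forall y, A y -> F y <= (c + eps) * G y.
  apply: (minmax_lt Ggt0); rewrite -[minmax _ _ _]/(plap_minmax e w p i) Ei.
  by rewrite lte_fin ltrDl.
have [y yA|s' s'lt /Ai is'] := small A Ac As A0.
  by have := Alt y yA; rewrite mulrDl; lra.
by lia.
Qed.

End BlockBounds.

(** * Independent sets and components of supports *)

Section IndependentSets.
Variables (R : realType) (n : nat) (e : rel 'I_n) (w : 'I_n -> 'I_n -> R) (p : R).
Hypothesis e_sym : symmetric e.
Hypothesis e_irr : irreflexive e.
Hypothesis w_sym : forall i j : 'I_n, e i j -> w i j = w j i.
Hypothesis p_ge1 : 1 <= p.

(** Each edge has at most one end in [S], so its energy is the sum of the
    contributions of its two ends. *)
Lemma independent_energy (S : {set 'I_n}) (y : 'rV[R]_n) :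
  independent e S -> (forall u, u \notin S -> y 0 u = 0) ->
  plap_num e w p y = plap_den e w p y.
Proof.
move=> indep yS; pose a i := abs_pow p (y 0 i).
have edge i j : e i j -> abs_pow p (y 0 i - y 0 j) = a i + a j.
  move=> eij; have [iS|iS] := boolP (i \in S); last first.
    by rewrite /a (yS i iS) sub0r abs_powN abs_pow0// add0r.
  have [jS|jS] := boolP (j \in S); last first.
    by rewrite /a (yS j jS) subr0 abs_pow0// addr0.
  by have /forall_inP/(_ i iS)/forall_inP/(_ j jS) := indep; rewrite eij.
transitivity (\sum_(i < n) \sum_(j < n | (i < j)%N && e i j) w i j * a i +
    \sum_(i < n) \sum_(j < n | (i < j)%N && e i j) w i j * a j).
  rewrite -big_split /=; apply: eq_bigr => i _; rewrite -big_split /=.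
  by apply: eq_bigr => j /andP[_ eij]; rewrite -mulrDr -edge.
rewrite [X in _ + X](exchange_big_dep xpredT)//= -big_split /=.
apply: eq_bigr => i _; rewrite -[X in _ * X]/(a i) /wdeg mulr_suml.
rewrite [RHS](bigID (fun j : 'I_n => (i < j)%N)) /=; congr (_ + _).
  by apply: eq_bigl => j; rewrite andbC.
apply: eq_big => [j|j /andP[_ eji]]; last by rewrite w_sym.
rewrite e_sym -leqNgt andbC [in RHS]leq_eqVlt andb_orr.
by case: eqP => [/ord_inj ->|_]; rewrite ?e_irr ?andbF.
Qed.

Lemma card_ord_lt m : (m <= n)%N -> #|[set i : 'I_n | (i < m)%N]%SET| = m.
Proof.
move=> mn; rewrite -sum1_card (eq_bigl (fun i : 'I_n => (i < m)%N)) => [|i].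
  by rewrite (big_ord_narrow mn) sum1_card card_ord.
by rewrite inE.
Qed.

Lemma card_ord_ge m : (m <= n)%N -> #|[set i : 'I_n | (n - m <= i)%N]%SET| = m.
Proof.
move=> mn; have -> : [set i : 'I_n | (n - m <= i)%N]%SET =
    (~: [set i : 'I_n | (i < n - m)%N])%SET.
  by apply/setP => i; rewrite !inE leqNgt.
by rewrite cardsCs finset.setCK card_ord card_ord_lt ?leq_subr// subKn.
Qed.

End IndependentSets.

(** By homogeneity, [eigen_rayleigh] applies with the eigenvector itself as
    the test direction. *)
Lemma plap_eigenvalue_ge0 (R : realType) (n : nat) (e : rel 'I_n)
    (w : 'I_n -> 'I_n -> R) (p : R) (lam : R) (x : 'rV[R]_n) :
  (forall i j : 'I_n, e i j -> 0 < w i j) ->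
  (forall i : 'I_n, exists j : 'I_n, e i j) -> 1 <= p ->
  plap_eigenpair e w p lam x -> 0 <= lam.
Proof.
move=> w_gt0 no_isolated p_ge1 eig.
have Fx0 : 0 <= plap_num e w p x by exact: plap_num_ge0.
have Gx0 : 0 < plap_den e w p x by apply: plap_den_gt0 => //; case: eig.
have radial (Q : 'rV[R]_n -> R) : (forall t y, Q (t *: y) = abs_pow p t * Q y) ->
    forall s, `|s| < 1 -> Q (x + s *: x) - Q x = ((1 + s) `^ p - 1) * Q x.
  move=> QZ s; rewrite ltr_norml => s1.
  have -> : x + s *: x = (1 + s) *: x by rewrite scalerDl scale1r.
  by rewrite QZ /abs_pow ger0_norm; [ring | lra].
have rayleigh : plap_num e w p x = lam * plap_den e w p x.
  apply: (eigen_rayleigh p_ge1 _ _ _ _ eig) => //.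
  - exact: plap_num_convex.
  - exact: plap_den_convex.
  - exact: plap_num_continuous.
  - exact: plap_den_continuous.
  - exact: radial (plap_numZ e w p).
  - exact: radial (plap_denZ e w p).
by move: Fx0; rewrite rayleigh pmulr_lge0.
Qed.

Theorem proposition1p3 (R : realType) (n : nat) (e : rel 'I_n)
    (w : 'I_n -> 'I_n -> R) (p : R)
    (e_sym : symmetric e) (e_irr : irreflexive e)
    (w_sym : forall i j : 'I_n, e i j -> w i j = w j i)
    (w_gt0 : forall i j : 'I_n, e i j -> 0 < w i j)
    (no_isolated : forall i : 'I_n, exists j : 'I_n, e i j)
    (p_ge1 : 1 <= p) :
  (independence_number e <=
     minn #|[set i : 'I_n | (plap_minmax e w p i.+1 <= 1%:E)%E]%SET|
          #|[set i : 'I_n | (1%:E <= plap_minmax e w p i.+1)%E]%SET|)%N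
  /\
  (forall (i : nat) (lam : R) (x : 'rV[R]_n) (r : nat),
     (1 <= i <= n)%N ->
     plap_minmax e w p i = lam%:E ->
     plap_eigenpair e w p lam x ->
     plap_multiplicity e w p lam = (r%:R : R)%:E ->
     (num_components e (supp x) <= minn (i + r - 1) (n - i + r))%N).
Proof.
split=> [|i lam x r i_bounds Ei eig mult].
  apply/bigmax_leqP => S indep.
  pose x : 'rV[R]_n := \row_u (u \in S)%:R.
  have xS : supp x = S by apply/setP => u; rewrite inE mxE pnatr_eq0 eqb0 negbK.
  have repsS : block_reps x id = S.
    by rewrite /block_reps xS; apply/setP => u; rewrite inE eqxx andbT.
  have Sn : (#|S| <= n)%N by rewrite -[leqRHS]card_ord max_card.
  have flat t : plap_num e w p (scale_blocks x id t) =
      1 * plap_den e w p (scale_blocks x id t).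
    rewrite mul1r; apply: (independent_energy e_sym e_irr w_sym p_ge1 indep) => // u uS.
    by rewrite !mxE (negPf uS) mulr0.
  rewrite leq_min; apply/andP; split.
    rewrite -(card_ord_lt Sn); apply/subset_leq_card/fintype.subsetP => i.
    rewrite !inE => iS; apply: (flat_minmax_le w_gt0 no_isolated flat).
    by rewrite repsS.
  rewrite -(card_ord_ge Sn); apply/subset_leq_card/fintype.subsetP => i.
  rewrite !inE => iS; apply: (flat_minmax_ge w_gt0 no_isolated _ flat) => //.
  by rewrite repsS ltnS.
pose l := fingraph.root (induced_rel e (supp x)).
have l_supp u : u \in supp x -> l u \in supp x by exact: root_in_set.
have l_idem u : u \in supp x -> l (l u) = l u.
  by move=> _; apply: root_root; exact: induced_connect_sym.
have l_edge u v : u \in supp x -> v \in supp x -> e u v -> l u = l v.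
  exact: root_edge.
rewrite num_components_reps.
apply: (flat_count_le w_gt0 no_isolated p_ge1 l_supp _ _ i_bounds Ei mult).
  exact: (eigen_blocks w_gt0 p_ge1 no_isolated l_supp l_idem l_edge eig).
exact: plap_eigenvalue_ge0 eig.
Qed.
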